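(* Let $d\ge3$. There exists $C\in\mathcal{C}^d_{ar}$ with the following properties: (1) $\mu_C$ is singular with respect to $\lambda_d$, has no point masses, and has full support $\mathbb{I}^d$; (2) for $\mu_{C^{1:d-1}}$-almost every $\mathbf{x}\in\mathbb{I}^{d-1}$ the conditional distribution function $y\mapsto K_C(\mathbf{x},[0,y])$ is a strictly increasing step function (i.e. a strictly increasing purely discrete distribution function); (3) there exists a dense countable subset $\mathcal{Q}\subseteq(0,1)$ such that $\mu_C(L_t)>0$ if and only if $t\in\mathcal{Q}$, where $L_t=\{\mathbf{u}\in\mathbb{I}^d:C(\mathbf{u})=t\}$; (4) the Kendall distribution function $F_K^d$ of $C$ is a strictly increasing step function.
   Context: $\mathbb{I}=[0,1]$. $\mathcal{C}^d_{ar}$ is the class of $d$-dimensional Archimedean copulas $C(\mathbf{u})=\psi(\sum_{i=1}^d\varphi(u_i))$, where $\psi:[0,\infty)\to\mathbb{I}$ is continuous, non-increasing, $\psi(0)=1$, $\lim_{z\to\infty}\psi(z)=0$, strictly decreasing on $[0,\inf\{z:\psi(z)=0\}]$, $\psi(1)=1/2$, with $(-1)^{d-2}\psi^{(d-2)}$ existing, non-negative, non-increasing and convex on $(0,\infty)$; $\varphi$ is the pseudo-inverse. $\mu_C$ is the measure of $C$; $C^{1:d-1}(\mathbf{x})=C(\mathbf{x},1)$; $K_C$ is the $(d-1)$-Markov kernel (regular conditional distribution of the last coordinate given the first $d-1$). $F_K^d(t)=\mu_C(\{\mathbf{u}:C(\mathbf{u})\le t\})$ is the Kendall distribution function. *)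

(* Defs.v *)
From HB Require Import structures.
From mathcomp Require Import all_boot all_order all_algebra.
From mathcomp Require Import all_classical all_reals all_analysis.
Set Implicit Arguments.
Unset Strict Implicit.
Unset Printing Implicit Defensive.
Import Order.TTheory GRing.Theory Num.Theory.
Import numFieldNormedType.Exports.
Local Open Scope classical_set_scope.
Local Open Scope ring_scope.

Definition level_inf (R : realType) (psi : R -> R) (t : R) : \bar R :=
  ereal_inf [set z%:E | z in [set z : R | 0 <= z /\ psi z = t]].

(* the pseudo-inverse phi of psi: phi t = psi^{-1}(t) for t in (0,1],
   phi 0 = inf {z : psi z = 0} (possibly +oo) *)
Definition pinv (R : realType) (psi : R -> R) (t : R) : \bar R := level_inf psi t.

(* psi extended to [0, +oo] by psi(+oo) = lim_{z -> oo} psi z = 0 *)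
Definition psiE (R : realType) (psi : R -> R) (z : \bar R) : R :=
  match z with
  | EFin r => psi r
  | +oo%E => 0
  | -oo%E => 1
  end.

Definition arch_copula (R : realType) (d : nat) (psi : R -> R) (u : 'I_d -> R) : R :=
  psiE psi (\sum_(i < d) pinv psi (u i))%E.

Definition arch_generator (R : realType) (d : nat) (psi : R -> R) : Prop :=
  let g := fun x => (-1) ^+ (d - 2) * derive1n (d - 2) psi x in
  [/\ [/\ {within [set z : R | 0 <= z], continuous psi},
          (forall z, 0 <= z -> 0 <= psi z <= 1),
          (forall x y, 0 <= x -> x <= y -> psi y <= psi x) &
          psi 0 = 1],
      [/\ psi x @[x --> +oo] --> (0 : R),
          (forall x y, 0 <= x -> x < y -> (y%:E <= level_inf psi 0)%E -> psi y < psi x) &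
          psi 1 = 2^-1] &
      [/\
          (forall k, (k < d - 2)%N -> forall x, 0 < x -> derivable (derive1n k psi) x 1),
          (forall x, 0 < x -> 0 <= g x),
          (forall x y, 0 < x -> x <= y -> g y <= g x) &
          (forall x y t, 0 < x -> 0 < y -> 0 <= t <= 1 ->
             g (t * x + (1 - t) * y) <= t * g x + (1 - t) * g y)]].

(* ---------- the measurable space R^d (Borel = product sigma-algebra) ---------- *)

Definition cyl (R : realType) (d : nat) : set (set ('I_d -> R)) :=
  [set A | exists i : 'I_d, exists B : set R, measurable B /\ A = [set u | B (u i)]].
Arguments cyl : clear implicits.

Definition Rsp (R : realType) (d : nat) := g_sigma_algebraType (cyl R d).

Definition cube (R : realType) (d : nat) : set ('I_d -> R) :=
  [set u | forall i, 0 <= u i <= 1].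
Arguments cube : clear implicits.

Definition box0 (R : realType) (d : nat) (u : 'I_d -> R) : set ('I_d -> R) :=
  [set v | forall i, 0 <= v i <= u i].

Definition copula_measure (R : realType) (d : nat) (C : ('I_d -> R) -> R)
    (mu : probability (Rsp R d) R) : Prop :=
  mu (cube R d : set (Rsp R d)) = 1%E /\
  forall u, cube R d u -> mu (box0 u : set (Rsp R d)) = (C u)%:E.

Definition lebesgue_null (R : realType) (d : nat) (N : set ('I_d -> R)) : Prop :=
  forall e : R, 0 < e ->
  exists a b : nat -> 'I_d -> R,
    [/\ (forall k i, a k i <= b k i),
        N `<=` \bigcup_k [set v | forall i, a k i <= v i <= b k i] &
        (\sum_(0 <= k <oo) (\prod_(i < d) (b k i - a k i))%:E <= e%:E)%E].

Definition singular_lebesgue (R : realType) (d : nat) (mu : probability (Rsp R d) R) : Prop :=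
  exists N : set (Rsp R d), [/\ measurable N, lebesgue_null (N : set ('I_d -> R)) &
                               mu (~` N) = 0%E].

Definition no_atoms (R : realType) (d : nat) (mu : probability (Rsp R d) R) : Prop :=
  forall x : 'I_d -> R, mu ([set x] : set (Rsp R d)) = 0%E.

Definition supball (R : realType) (d : nat) (x : 'I_d -> R) (e : R) : set ('I_d -> R) :=
  [set v | forall i, `|v i - x i| < e].

Definition msupport (R : realType) (d : nat) (mu : probability (Rsp R d) R) : set ('I_d -> R) :=
  [set x | forall e : R, 0 < e -> (0 < mu (supball x e : set (Rsp R d)))%E].

Definition initc (R : realType) (n : nat) (u : 'I_n.+1 -> R) : 'I_n -> R :=
  fun j => u (widen_ord (leqnSn n) j).

Definition lastc (R : realType) (n : nat) (u : 'I_n.+1 -> R) : R := u ord_max.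

Definition is_marginal (R : realType) (n : nat) (mu : probability (Rsp R n.+1) R)
    (nu : probability (Rsp R n) R) : Prop :=
  forall A : set (Rsp R n), measurable A ->
    nu A = mu ([set u | A (initc u)] : set (Rsp R n.+1)).

Definition is_markov_kernel (R : realType) (n : nat) (mu : probability (Rsp R n.+1) R)
    (nu : probability (Rsp R n) R) (K : R.-pker (Rsp R n) ~> R) : Prop :=
  forall (A : set (Rsp R n)) (B : set R), measurable A -> measurable B ->
    mu ([set u | A (initc u) /\ B (lastc u)] : set (Rsp R n.+1)) =
    (\int[nu]_(x in A) K x B)%E.

Definition strict_incr_step (R : realType) (F : R -> R) : Prop :=
  (forall x y, 0 <= x -> x < y -> y <= 1 -> F x < F y) /\
  exists (S : set R) (w : R -> R),
    [/\ countable S, S `<=` [set z | 0 <= z <= 1], (forall s, 0 <= w s) &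
        forall y, 0 <= y <= 1 ->
          (F y)%:E = \esum_(s in [set s | S s /\ s <= y]) (w s)%:E].

Definition level_set (R : realType) (d : nat) (C : ('I_d -> R) -> R) (t : R) : set ('I_d -> R) :=
  [set u | cube R d u /\ C u = t].

Definition kendall_df (R : realType) (d : nat) (C : ('I_d -> R) -> R)
    (mu : probability (Rsp R d) R) (t : R) : R :=
  fine (mu ([set u | cube R d u /\ C u <= t] : set (Rsp R d))).

(* Main.v *)
Require Import Defs.
From HB Require Import structures.
From mathcomp Require Import all_boot all_order all_algebra.
From mathcomp Require Import all_classical all_reals all_analysis.
From mathcomp Require Import ring lra measurable_realfun.
Set Implicit Arguments.
Unset Strict Implicit.
Unset Printing Implicit Defensive.
Import Order.TTheory GRing.Theory Num.Theory.
Import numFieldNormedType.Exports.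
Local Open Scope classical_set_scope.
Local Open Scope ring_scope.

(** The generator is the Williamson transform
    psi(z) = sum_k g_k (1 - z / r_k)_+^n of a discrete probability measure whose
    atoms r_k are dense in (0, oo).  The copula is then the law of
    (psi(R S_1), ..., psi(R S_{n+1})), where R = r_k with probability g_k and S is
    uniform on the unit simplex; on {R = r_k} it lives on the level set
    {C = psi(r_k)}.  These level sets are Lebesgue null, and the mass of the
    level t and the Kendall distribution are read off from the g_k.  Given the
    first n coordinates, with s the sum of their images under psi^{-1}, the last
    one takes the values psi(r_k - s), r_k >= s, with probabilities proportional
    to g_k / r_k^n, since the first n coordinates of r_k S have constant density
    n! / r_k^n on {x >= 0, sum x <= r_k}.  Density of the atoms gives full support
    and strict monotonicity of all the distribution functions. *)

(** The exponent [n] = d - 1 is as small as the definition of a generator permits: after d - 2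
    derivatives the summands are tents, convex but no longer differentiable. All analytic facts
    about psi come from explicit bounds on series, summed under one condition on the weights. Since
    the radii are unbounded, psi never vanishes, its inverse is finite on (0,1], and the normalising
    constant of the conditional law is positive for every s. Of Lebesgue measure on R^n only the
    volumes (s - sum a)^n / n! of corner simplices are used; they are what turns box probabilities
    into the Williamson transform. The claims concern every measure of the copula and every version
    of its kernel. The first is settled by uniqueness on orthants. A kernel is only determined
    almost everywhere for each fixed right endpoint, so it is identified at all rational endpoints
    at once and then everywhere by right-continuity. The value psi(1) = 1/2 is reached by rescaling
    the radii. *)

Section dominated_series.
Variable R : realType.
Implicit Types a b c : nat -> R.

Definition rsum a : R := limn (series a).

Lemma series_dominated_cvg b a M :
  cvgn (series b) -> (forall k, `|a k| <= M * b k) -> cvgn (series a).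
Proof.
move=> cb ab; apply: normed_cvg.
apply: (@series_le_cvg _ _ (fun k => M * b k)) => [k|k|//|].
- exact: normr_ge0.
- exact: le_trans (normr_ge0 _) (ab k).
- exact: (is_cvg_seriesZ cb).
Qed.

Lemma rsumD a c : cvgn (series a) -> cvgn (series c) ->
  rsum (fun k => a k + c k) = rsum a + rsum c.
Proof. exact: lim_seriesD. Qed.

Lemma rsumB a c : cvgn (series a) -> cvgn (series c) ->
  rsum (fun k => a k - c k) = rsum a - rsum c.
Proof. exact: lim_seriesB. Qed.

Lemma rsumZ x a : cvgn (series a) -> rsum (fun k => x * a k) = x * rsum a.
Proof. exact: lim_seriesZ. Qed.

Lemma ler_rsum a c : cvgn (series a) -> cvgn (series c) ->
  (forall k, a k <= c k) -> rsum a <= rsum c.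
Proof. exact: lim_series_le. Qed.

Lemma rsum_ge_term a k : cvgn (series a) -> (forall j, 0 <= a j) ->
  a k <= rsum a.
Proof.
move=> ca a0; apply: (@le_trans _ _ (series a k.+1)).
  rewrite seriesEnat /= big_nat_recr //= lerDr.
  by apply: sumr_ge0.
apply: nondecreasing_cvgn_le => //.
apply/nondecreasing_seqP => j.
by rewrite seriesEnat /= big_nat_recr //= lerDl.
Qed.

Lemma ltr_rsum a c : cvgn (series a) -> cvgn (series c) ->
  (forall k, a k <= c k) -> (exists k, a k < c k) -> rsum a < rsum c.
Proof.
move=> ca cc ac [k ack]; rewrite -subr_gt0 -rsumB //.
apply: (@lt_le_trans _ _ (c k - a k)); first by rewrite subr_gt0.
apply: (@rsum_ge_term (fun k => c k - a k)) => [|j]; last by rewrite subr_ge0.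
exact: is_cvg_seriesB.
Qed.

Lemma rsum_dominated b a M : cvgn (series b) ->
  (forall k, `|a k| <= M * b k) -> `|rsum a| <= M * rsum b.
Proof.
move=> cb ab.
have cna : cvgn (series (fun k => `|a k|)).
  by apply: (series_dominated_cvg cb (M := M)) => k; rewrite normr_id.
rewrite -rsumZ //; apply: (le_trans (lim_series_norm cna)).
apply: ler_rsum => //; exact: (is_cvg_seriesZ cb).
Qed.

Lemma rsumE a : cvgn (series a) -> (\sum_(k <oo) (a k)%:E)%E = (rsum a)%:E.
Proof.
move=> ca; rewrite /rsum -EFin_lim //; congr (limn _); apply/funext => k /=.
by rewrite sumEFin seriesEnat.
Qed.

End dominated_series.

(** * Elementary inequalities for powers and truncated linear functions *)

Section unit_powers.
Variable R : realFieldType.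
Implicit Types a b : R.

Lemma expr_lipschitz m a b : 0 <= a <= 1 -> 0 <= b <= 1 ->
  `|b ^+ m - a ^+ m| <= m%:R * `|b - a|.
Proof.
move=> /andP[a0 a1] /andP[b0 b1].
elim: m => [|m IH]; first by rewrite !expr0 subrr normr0 mul0r.
have -> : b ^+ m.+1 - a ^+ m.+1 = b * (b ^+ m - a ^+ m) + (b - a) * a ^+ m.
  by rewrite !exprS; ring.
apply: (le_trans (ler_normD _ _)); rewrite !normrM.
have -> : m.+1%:R * `|b - a| = m%:R * `|b - a| + `|b - a|.
  by rewrite -natr1; ring.
apply: lerD.
  by rewrite ger0_norm //; apply: le_trans IH; rewrite ler_piMl.
by rewrite ler_piMr // ger0_norm ?exprn_ge0 // exprn_ile1.
Qed.

(** A second-order Taylor bound by pure algebra: the induction step adds [m.+1 * (b - a)^2 * a^m],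
    and (m+1)^2 + (m+1) <= (m+2)^2. *)
Lemma expr_taylor2 m a b : 0 <= a <= 1 -> 0 <= b <= 1 ->
  `|b ^+ m.+1 - a ^+ m.+1 - m.+1%:R * (b - a) * a ^+ m|
    <= m.+1%:R ^+ 2 * (b - a) ^+ 2.
Proof.
move=> /andP[a0 a1] /andP[b0 b1].
elim: m => [|m IH].
  rewrite !expr1 expr0 mulr1 mul1r subrr normr0.
  by rewrite mulr_ge0 ?sqr_ge0.
have -> : b ^+ m.+2 - a ^+ m.+2 - m.+2%:R * (b - a) * a ^+ m.+1 =
   b * (b ^+ m.+1 - a ^+ m.+1 - m.+1%:R * (b - a) * a ^+ m)
   + m.+1%:R * (b - a) ^+ 2 * a ^+ m.
  by rewrite -[m.+2%:R]natr1 !exprS; ring.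
apply: (le_trans (ler_normD _ _)).
rewrite [`|b * _|]normrM (ger0_norm b0).
apply: (@le_trans _ _ (m.+1%:R ^+ 2 * (b - a) ^+ 2 + m.+1%:R * (b - a) ^+ 2)).
  apply: lerD; first by apply: le_trans IH; rewrite ler_piMl.
  rewrite ger0_norm; last by apply: mulr_ge0; [apply: mulr_ge0; [|exact: sqr_ge0]|exact: exprn_ge0].
  by apply: ler_piMr; [apply: mulr_ge0 => //; exact: sqr_ge0|exact: exprn_ile1].
rewrite -mulrDl; apply: ler_wpM2r; first exact: sqr_ge0.
have m0 : (0 : R) <= m.+1%:R by exact: ler0n.
by rewrite -[m.+2%:R]natr1; nra.
Qed.

End unit_powers.

Section tent.
Variable R : realFieldType.
Implicit Types r x y z : R.

(** The inner maximum freezes the value at 1 for negative [z], so that monotonicity, the Lipschitz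
    bound and continuity hold on the whole line. *)
Definition tent r z : R := Num.max 0 (1 - Num.max 0 z / r).

Lemma tent_itv r z : 0 < r -> 0 <= tent r z <= 1.
Proof.
move=> r0; rewrite /tent le_max lexx /= ge_max ler01 /= gerBl.
by rewrite divr_ge0 ?(ltW r0) // le_max lexx.
Qed.

Lemma tent_ge0 r z : 0 < r -> 0 <= tent r z.
Proof. by move=> /tent_itv -/(_ z)/andP[]. Qed.

Lemma tent_le1 r z : 0 < r -> tent r z <= 1.
Proof. by move=> /tent_itv -/(_ z)/andP[]. Qed.

Lemma tentE r z : 0 <= z -> tent r z = Num.max 0 (1 - z / r).
Proof. by move=> z0; rewrite /tent (max_r z0). Qed.

Lemma tent_neg r z : z <= 0 -> tent r z = 1.
Proof. by move=> z0; rewrite /tent (max_l z0) mul0r subr0 max_r. Qed.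

Lemma tent_eq0 r z : 0 < r -> r <= z -> tent r z = 0.
Proof.
move=> r0 rz; rewrite tentE ?(le_trans (ltW r0)) // max_l // subr_le0.
by rewrite ler_pdivlMr // mul1r.
Qed.

Lemma tent_pos r z : 0 <= z -> z <= r -> 0 < r -> tent r z = 1 - z / r.
Proof.
move=> z0 zr r0; rewrite tentE // max_r // subr_ge0.
by rewrite ler_pdivrMr // mul1r.
Qed.

Lemma max0_lipschitz x y : `|Num.max 0 x - Num.max 0 y| <= `|x - y|.
Proof.
by have [x0|x0] := leP 0 x; have [y0|y0] := leP 0 y;
  rewrite ler_norml; case: (ger0P (x - y)) => ?; apply/andP; split; lra.
Qed.

Lemma tent_lipschitz r x y : 0 < r -> `|tent r x - tent r y| <= `|x - y| / r.
Proof.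
move=> r0; apply: (le_trans (max0_lipschitz _ _)).
have -> : 1 - Num.max 0 x / r - (1 - Num.max 0 y / r) =
          (Num.max 0 y - Num.max 0 x) / r by field; rewrite gt_eqF.
rewrite normrM [X in _ * X]ger0_norm ?invr_ge0 ?(ltW r0) //.
by rewrite ler_wpM2r ?invr_ge0 ?(ltW r0) // distrC max0_lipschitz.
Qed.

Lemma tent_le r x y : 0 < r -> x <= y -> tent r y <= tent r x.
Proof.
move=> r0 xy; rewrite /tent.
rewrite ge_max le_max lexx /= le_max; apply/orP; right.
rewrite lerB // ler_wpM2r ?invr_ge0 ?(ltW r0) //.
by rewrite ge_max !le_max lexx xy orbT.
Qed.

Lemma tent_lt r x y : 0 <= x -> x < y -> x < r -> tent r y < tent r x.
Proof.
move=> x0 xy xr; have r0 : 0 < r by exact: le_lt_trans xr.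
rewrite [X in _ < X]tent_pos ?(ltW xr) // tentE; last first.
  by rewrite (le_trans x0) // ltW.
by rewrite gt_max subr_gt0 ltr_pdivrMr // mul1r xr /= ltrD2l ltrN2 ltr_pM2r // invr_gt0.
Qed.

Lemma tent_convex r x y t : 0 < r -> 0 <= x -> 0 <= y -> 0 <= t <= 1 ->
  tent r (t * x + (1 - t) * y) <= t * tent r x + (1 - t) * tent r y.
Proof.
move=> r0 x0 y0 /andP[t0 t1].
have t1' : 0 <= 1 - t by rewrite subr_ge0.
rewrite !tentE ?addr_ge0 ?mulr_ge0 // ge_max; apply/andP; split.
  by rewrite addr_ge0 // mulr_ge0 // le_max lexx.
have -> : 1 - (t * x + (1 - t) * y) / r =
   t * (1 - x / r) + (1 - t) * (1 - y / r) by field; rewrite gt_eqF.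
by apply: lerD; rewrite ler_wpM2l // le_max lexx orbT.
Qed.

Lemma tent_decay r z : 0 < r -> 0 < z -> tent r z <= r / z.
Proof.
move=> r0 z0; have [zr|rz] := leP z r.
  rewrite (le_trans (tent_le1 _ r0)) //.
  by rewrite ler_pdivlMr // mul1r.
by rewrite tent_eq0 // ?divr_ge0 ?ltW.
Qed.

(** The exponent is at least 2, which tames the kink at [r]: when the kink is crossed, the tent
    itself is of order [h / r]. Positivity of [z] and [z + h] avoids the kink at 0. The bound
    involves only [h / r], so it can be summed over all radii. *)
Lemma tent_taylor2 m r z h : 0 < r -> 0 < z -> 0 < z + h ->
  `|tent r (z + h) ^+ m.+2 - tent r z ^+ m.+2
      + m.+2%:R * (h / r) * tent r z ^+ m.+1|
    <= (m.+2%:R ^+ 2 + m.+2%:R) * (h / r) ^+ 2.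
Proof.
move=> r0 z0 zh0; set a := tent r z; set b := tent r (z + h); set d := h / r.
have a01 : 0 <= a <= 1 := tent_itv z r0.
have b01 : 0 <= b <= 1 := tent_itv (z + h) r0.
have dba : `|b - a| <= `|d|.
  apply: (le_trans (tent_lipschitz _ _ r0)); rewrite addrAC subrr add0r.
  by rewrite normrM [`|r^-1|]ger0_norm // invr_ge0 ltW.
have -> : b ^+ m.+2 - a ^+ m.+2 + m.+2%:R * d * a ^+ m.+1 =
    (b ^+ m.+2 - a ^+ m.+2 - m.+2%:R * (b - a) * a ^+ m.+1)
    + m.+2%:R * ((d + (b - a)) * a ^+ m.+1) by ring.
apply: (le_trans (ler_normD _ _)); rewrite [X in _ <= X]mulrDl; apply: lerD.
  apply: (le_trans (expr_taylor2 m.+1 a01 b01)).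
  apply: ler_wpM2l; first exact: sqr_ge0.
  rewrite -[(b - a) ^+ 2]real_normK ?num_real // -[d ^+ 2]real_normK ?num_real //.
  by rewrite lerXn2r ?nnegrE.
rewrite normrM ger0_norm // ler_wpM2l //.
(* Either neither truncation is active and [d + (b - a) = 0], or [a <= |d|]. *)
have [zr|rz] := leP r z.
  have -> : a = 0 by exact: tent_eq0.
  by rewrite expr0n /= mulr0 normr0 sqr_ge0.
have aE : a = 1 - z / r by rewrite /a tent_pos ?ltW.
have [zhr|rzh] := leP (z + h) r.
  have -> : d + (b - a) = 0.
    rewrite /b (tent_pos (ltW zh0) zhr r0) aE /d; field; by rewrite gt_eqF.
  by rewrite mul0r normr0 sqr_ge0.
have bE : b = 0 by rewrite /b tent_eq0 // ltW.
have ad : a <= d.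
  by rewrite aE /d lerBlDr -mulrDl addrC ler_pdivlMr // mul1r ltW.
case/andP: a01 => a0 a1.
have d0 : 0 <= d by exact: le_trans ad.
rewrite bE sub0r normrM [`|a ^+ _|]ger0_norm ?exprn_ge0 // exprS mulrA.
apply: (@le_trans _ _ (`|d - a| * a)).
  by rewrite ler_piMr ?mulr_ge0 // exprn_ile1.
rewrite ger0_norm ?subr_ge0 // expr2 ler_pM ?subr_ge0 //.
by rewrite gerBl.
Qed.

End tent.

(** An explicit quadratic error survives summation, so this criterion replaces a theorem on termwise
    differentiation of series. *)
Lemma is_derive_quadratic (R : realType) (f : R -> R) (z l C : R) :
  0 < z -> (forall h, 0 < z + h -> `|f (z + h) - f z - h * l| <= C * h ^+ 2) ->
  is_derive z 1 f l.
Proof.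
move=> z0 Hf.
have H : h^-1 *: (f (h *: 1 + z) - f z) @[h --> 0^'] --> l.
  apply/cvgrPdist_le => e e0.
  have C0 : 0 < `|C| + 1 by rewrite ltr_wpDl.
  near=> h.
  have h0 : h != 0 by near: h; exact: nbhs_dnbhs_neq.
  have hz : `|h| < z.
    by near: h; apply: dnbhs0_lt.
  have zh : 0 < z + h by move: hz; rewrite ltr_norml => /andP[? ?]; lra.
  have -> : l - h^-1 *: (f (h *: 1 + z) - f z)
          = - (h^-1 * (f (z + h) - f z - h * l)).
    rewrite /GRing.scale /= mulr1 [h + z]addrC; field; exact: h0.
  rewrite normrN normrM normfV ler_pdivrMl ?normr_gt0 //.
  apply: (le_trans (Hf h zh)).
  apply: (@le_trans _ _ (`|C| * (`|h| * `|h|))).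
    by rewrite -expr2 real_normK ?num_real // ler_wpM2r ?sqr_ge0 // ler_norm.
  rewrite mulrCA ler_wpM2l //.
  apply: (@le_trans _ _ ((`|C| + 1) * `|h|)); first by rewrite ler_wpM2r // lerDl.
  rewrite -ler_pdivlMl //.
  by near: h; apply: dnbhs0_le; rewrite mulrC divr_gt0.
have dH : derivable f z 1 by apply/cvg_ex; exists l.
by apply: DeriveDef => //; apply/cvg_lim.
Unshelve. all: by end_near. Qed.

(** * The Williamson generator: derivatives, monotonicity, inverse *)

Section generator.
Variables (R : realType) (n : nat) (r g : nat -> R).

(** In [mw_cvg] the summand [r k] controls the decay of psi at infinity, and [r k ^- n] controls its
    derivatives and the density of the first [n] coordinates. *)
Record mixing_weights : Prop := MixingWeights {
  mw_r_gt0 : forall k, 0 < r k;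
  mw_g_gt0 : forall k, 0 < g k;
  mw_r_inj : injective r;
  mw_r_dense : forall a b, 0 <= a -> a < b -> exists k, a < r k < b;
  mw_cvg : cvgn (series (fun k => g k * (1 + r k + r k ^- n)));
  mw_sum1 : rsum g = 1 }.

(* Up to the factor (-1)^j n (n-1) ... (n-j+1), the j-th derivative of the
   Williamson transform z |-> sum_k g_k (1 - z / r_k)_+^n. *)
Definition gen_deriv (j : nat) (z : R) : R :=
  rsum (fun k => g k * r k ^- j * tent (r k) z ^+ (n - j)).

Definition gen : R -> R := gen_deriv 0.

(** Outside (0,1] the level is never attained and the infimum is [+oo], which [fine] sends to 0;
    hence the function is nonnegative and measurable on the whole line. *)
Definition gen_inv (t : R) : R := fine (level_inf gen t).

Hypothesis mw : mixing_weights.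

Let r0 := mw_r_gt0 mw.
Let g0 := mw_g_gt0 mw.
Let b k := g k * (1 + r k + r k ^- n).
Let cb : cvgn (series b) := mw_cvg mw.

Lemma invr_pow_le (x : R) j : 0 < x -> (j <= n)%N -> x ^- j <= 1 + x ^- n.
Proof.
move=> x0 jn; rewrite -!exprVn.
have [x1|x1] := leP x^-1 1.
  apply: (@le_trans _ _ 1); first by rewrite exprn_ile1 // invr_ge0 ltW.
  by rewrite lerDl exprn_ge0 // invr_ge0 ltW.
apply: (@le_trans _ _ (x^-1 ^+ n)); first by rewrite ler_weXn2l // ltW.
by rewrite lerDr.
Qed.

Lemma weight_ge0 j k : 0 <= g k * r k ^- j.
Proof. by rewrite mulr_ge0 ?invr_ge0 ?exprn_ge0 ?ltW. Qed.

Lemma weight_le j k : (j <= n)%N -> g k * r k ^- j <= b k.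
Proof.
move=> jn; rewrite /b (ler_wpM2l (ltW (g0 k))) //.
by apply: (le_trans (invr_pow_le (r0 k) jn)); rewrite lerD2r lerDl ltW.
Qed.

Lemma gen_term_itv j m k z : (j <= n)%N ->
  0 <= g k * r k ^- j * tent (r k) z ^+ m <= b k.
Proof.
move=> jn.
have w0 := weight_ge0 j k.
have [t0 t1] := andP (tent_itv z (r0 k)).
rewrite mulr_ge0 ?exprn_ge0 //=.
apply: le_trans (weight_le k jn).
by rewrite ler_piMr // exprn_ile1.
Qed.

Lemma weight_cvg j : (j <= n)%N -> cvgn (series (fun k => g k * r k ^- j)).
Proof.
move=> jn; apply: (series_dominated_cvg cb (M := 1)) => k.
by rewrite (ger0_norm (weight_ge0 j k)) mul1r weight_le.
Qed.

Lemma mw_cvg_g : cvgn (series g).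
Proof.
rewrite (_ : g = fun k => g k * r k ^- 0); first exact: weight_cvg.
by apply/funext => k; rewrite expr0 invr1 mulr1.
Qed.

Lemma gen_term_cvg j m z : (j <= n)%N ->
  cvgn (series (fun k => g k * r k ^- j * tent (r k) z ^+ m)).
Proof.
move=> jn; apply: (series_dominated_cvg cb (M := 1)) => k.
have /andP[t0 t1] := gen_term_itv m k z jn.
by rewrite ger0_norm // mul1r.
Qed.

Lemma genE z : gen z = rsum (fun k => g k * tent (r k) z ^+ n).
Proof.
rewrite /gen /gen_deriv; congr rsum; apply/funext => k.
by rewrite expr0 invr1 mulr1 subn0.
Qed.

Lemma gen_cvg z : cvgn (series (fun k => g k * tent (r k) z ^+ n)).
Proof.
rewrite (_ : (fun k => _) = fun k => g k * r k ^- 0 * tent (r k) z ^+ n).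
  exact: gen_term_cvg.
by apply/funext => k; rewrite expr0 invr1 mulr1.
Qed.

Lemma gen_neg z : z <= 0 -> gen z = 1.
Proof.
move=> z0; rewrite genE -[RHS](mw_sum1 mw); congr rsum; apply/funext => k.
by rewrite tent_neg // expr1n mulr1.
Qed.

(** The condition on [j] serves twice: it makes the exponent [n - j] at least 2, as [tent_taylor2]
    asks, and the error [(h / r k)^2] turns the weight into [r k ^- (j + 2)], still summable. *)
Lemma gen_deriv_is_derive j (z : R) : (j + 2 <= n)%N -> 0 < z ->
  is_derive z 1 (gen_deriv j) (- (n - j)%:R * gen_deriv j.+1 z).
Proof.
move=> jn z0.
have j2n : (j.+2 <= n)%N by rewrite -addn2.
have j1n : (j.+1 <= n)%N by exact: leq_trans j2n.
have jn' : (j <= n)%N by exact: leq_trans j1n.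
have [m nE] : exists m, (n = m.+2 + j)%N.
  by exists (n - j.+2)%N; rewrite -[LHS](subnK j2n) !addnS !addSn.
have nj : (n - j = m.+2)%N by rewrite nE addnK.
have nj1 : (n - j.+1 = m.+1)%N by rewrite nE addSnnS addnK.
apply: (@is_derive_quadratic _ _ _ _ ((m.+2%:R ^+ 2 + m.+2%:R) * rsum b)) => // h zh.
have -> : gen_deriv j (z + h) - gen_deriv j z - h * (- (n - j)%:R * gen_deriv j.+1 z)
  = rsum (fun k => g k * r k ^- j * (tent (r k) (z + h) ^+ m.+2
      - tent (r k) z ^+ m.+2 + m.+2%:R * (h / r k) * tent (r k) z ^+ m.+1)).
  have -> : - (h * (- (n - j)%:R * gen_deriv j.+1 z))
    = (h * m.+2%:R) * gen_deriv j.+1 z by rewrite nj; ring.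
  rewrite /gen_deriv nj nj1.
  have c1 : cvgn (series (fun k => h * m.+2%:R *
      (g k * r k ^- j.+1 * tent (r k) z ^+ m.+1))).
    by apply: is_cvg_seriesZ; exact: gen_term_cvg.
  have c2 : cvgn (series (fun k => g k * r k ^- j * tent (r k) (z + h) ^+ m.+2 -
      g k * r k ^- j * tent (r k) z ^+ m.+2)).
    by apply: is_cvg_seriesB; exact: gen_term_cvg.
  rewrite -rsumZ; last exact: gen_term_cvg.
  rewrite -rsumB; [|exact: gen_term_cvg|exact: gen_term_cvg].
  rewrite -rsumD //; congr rsum; apply/funext => k.
  rewrite !exprS; field.
  by rewrite !gt_eqF ?exprn_gt0.
have -> : (m.+2%:R ^+ 2 + m.+2%:R) * rsum b * h ^+ 2 =
  ((m.+2%:R ^+ 2 + m.+2%:R) * h ^+ 2) * rsum b by ring.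
apply: rsum_dominated => // k.
rewrite normrM (ger0_norm (weight_ge0 j k)).
apply: (@le_trans _ _ (g k * r k ^- j * ((m.+2%:R ^+ 2 + m.+2%:R) * (h / r k) ^+ 2))).
  by rewrite (ler_wpM2l (weight_ge0 j k)) // tent_taylor2.
have -> : g k * r k ^- j * ((m.+2%:R ^+ 2 + m.+2%:R) * (h / r k) ^+ 2) =
  (m.+2%:R ^+ 2 + m.+2%:R) * h ^+ 2 * (g k * r k ^- j.+2).
  by rewrite !exprS; field; rewrite !gt_eqF ?exprn_gt0.
by rewrite ler_wpM2l ?weight_le // mulr_ge0 ?sqr_ge0 // addr_ge0 ?sqr_ge0.
Qed.

Lemma gen_deriv_scale_is_derive (c : R) j (z : R) : (j + 2 <= n)%N -> 0 < z ->
  is_derive z 1 (fun y => c * gen_deriv j y)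
    (c * (- (n - j)%:R * gen_deriv j.+1 z)).
Proof. by move=> jn z0; apply: is_deriveZ; exact: gen_deriv_is_derive. Qed.

Lemma gen_derive1n j z : (j < n)%N -> 0 < z ->
  derive1n j gen z = (-1) ^+ j * (n ^_ j)%:R * gen_deriv j z.
Proof.
elim: j z => [|j IH] z jn z0.
  by rewrite derive1n0 expr0 ffactn0 !mul1r.
rewrite derive1nS derive1E.
have j2 : (j + 2 <= n)%N by rewrite addn2.
have dj := gen_deriv_scale_is_derive ((-1) ^+ j * (n ^_ j)%:R) j2 z0.
(* The closed form is known only for positive arguments, hence on a neighbourhood of [z], which
   determines the derivative. *)
rewrite (near_eq_derive (g := fun y => (-1) ^+ j * (n ^_ j)%:R * gen_deriv j y)).
  rewrite derive_val exprS ffactnSr natrM; ring.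
near=> y; apply: IH; first exact: ltnW.
near: y; exact: lt_nbhsr.
Unshelve. all: by end_near. Qed.

Lemma gen_derivable j (z : R) : (j + 2 <= n)%N -> 0 < z -> derivable (derive1n j gen) z 1.
Proof.
move=> jn z0.
apply: (@near_eq_derivable _ _ _ (fun y => (-1) ^+ j * (n ^_ j)%:R * gen_deriv j y)).
  near=> y; apply/esym/gen_derive1n; first by rewrite (leq_trans _ jn) // addn2.
  near: y; exact: lt_nbhsr.
have dj := gen_deriv_scale_is_derive ((-1) ^+ j * (n ^_ j)%:R) jn z0.
exact: ex_derive.
Unshelve. all: by end_near. Qed.

Lemma gen_deriv_ge0 j z : (j <= n)%N -> 0 <= gen_deriv j z.
Proof.
move=> jn; have := @rsum_ge_term _ _ 0%N (@gen_term_cvg j (n - j)%N z jn).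
have t0 k := proj1 (andP (gen_term_itv (n - j)%N k z jn)).
by move=> /(_ t0); apply: le_trans; exact: t0.
Qed.

Lemma gen_deriv_le j x y : (j <= n)%N -> x <= y -> gen_deriv j y <= gen_deriv j x.
Proof.
move=> jn xy; apply: ler_rsum => [||k]; try exact: gen_term_cvg.
rewrite (ler_wpM2l (weight_ge0 j k)) //.
by rewrite lerXn2r ?nnegrE ?tent_ge0 // tent_le.
Qed.

(** At this order the exponent is 1, so the function is a positive combination of tents, each convex
    on the nonnegative half-line. *)
Lemma gen_deriv_convex j x y t : n = j.+1 -> 0 <= x -> 0 <= y -> 0 <= t <= 1 ->
  gen_deriv j (t * x + (1 - t) * y) <= t * gen_deriv j x + (1 - t) * gen_deriv j y.
Proof.
move=> nj x0 y0 t01.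
have jn : (j <= n)%N by rewrite nj.
have cg z : cvgn (series (fun k => g k * r k ^- j * tent (r k) z ^+ (n - j))).
  exact: gen_term_cvg.
have cgz c z : cvgn (series (fun k => c * (g k * r k ^- j * tent (r k) z ^+ (n - j)))).
  exact: is_cvg_seriesZ.
rewrite /gen_deriv -!rsumZ // -rsumD //.
apply: ler_rsum => // [|k]; first exact: is_cvg_seriesD.
have -> : (n - j = 1)%N by rewrite nj subSnn.
rewrite !expr1 [X in _ <= X + _]mulrCA [X in _ <= _ + X]mulrCA -mulrDr.
rewrite (ler_wpM2l (weight_ge0 j k)) //.
exact: tent_convex.
Qed.

Lemma gen_itv z : 0 <= gen z <= 1.
Proof.
rewrite gen_deriv_ge0 //= -(gen_neg (lexx 0)).
have [z0|z0] := leP 0 z; first exact: gen_deriv_le.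
by rewrite gen_neg ?(ltW z0) // gen_neg.
Qed.

Lemma gen_le x y : x <= y -> gen y <= gen x.
Proof. exact: gen_deriv_le. Qed.

(** Density supplies a radius above [x]; its summand decreases strictly while the others do not
    increase. *)
Lemma gen_lt x y : (0 < n)%N -> 0 <= x -> x < y -> gen y < gen x.
Proof.
move=> n0 x0 xy; rewrite !genE; apply: ltr_rsum; try exact: gen_cvg.
  move=> k; rewrite (ler_wpM2l (ltW (g0 k))) //.
  by rewrite lerXn2r ?nnegrE ?tent_ge0 // tent_le // ltW.
have [k /andP[k1 k2]] := mw_r_dense mw x0 xy.
exists k; rewrite ltr_pM2l // ltrXn2r ?nnegrE ?tent_ge0 ?lt0n_neq0 //.
exact: tent_lt.
Qed.

Lemma gen_gt0 z : (0 < n)%N -> 0 < gen z.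
Proof.
move=> n0; have z1 : Num.max 0 z < Num.max 0 z + 1 by rewrite ltrDl.
have := gen_lt n0 _ z1; rewrite le_max lexx => /(_ isT) h.
have : 0 <= gen (Num.max 0 z + 1) by case/andP: (gen_itv (Num.max 0 z + 1)).
move=> /le_lt_trans/(_ h)/lt_le_trans; apply; apply: gen_le.
by rewrite le_max lexx orbT.
Qed.

Lemma gen_inj x y : (0 < n)%N -> 0 <= x -> 0 <= y -> gen x = gen y -> x = y.
Proof.
move=> n0 x0 y0 e.
by have [/(gen_lt n0 x0)|/(gen_lt n0 y0)|//] := ltgtP x y; rewrite e ltxx.
Qed.

Lemma gen_lipschitz : (0 < n)%N -> exists2 L, 0 < L & forall x y, `|gen x - gen y| <= L * `|x - y|.
Proof.
(* The sum of [g k / r k] is at most [rsum b]; the added 1 makes the constant visibly positive, so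
   that it can be divided by. *)
move=> n0; exists (n%:R * rsum b + 1) => [|x y].
  rewrite ltr_wpDl // mulr_ge0 //.
  have b0 k : 0 <= b k.
    have /andP[t0 t1] := gen_term_itv 0 k 0 (leq0n n).
    exact: le_trans t1.
  by apply: le_trans (rsum_ge_term 0%N cb b0).
rewrite !genE -rsumB; try exact: gen_cvg.
apply: (@le_trans _ _ ((n%:R * `|x - y|) * rsum b)).
  apply: rsum_dominated => // k.
  rewrite -mulrBr normrM gtr0_norm //.
  apply: (@le_trans _ _ (g k * (n%:R * (`|x - y| / r k)))).
    rewrite (ler_wpM2l (ltW (g0 k))) //.
    apply: (le_trans (expr_lipschitz n (tent_itv y (r0 k)) (tent_itv x (r0 k)))).
    by rewrite ler_wpM2l // tent_lipschitz.
  have -> : g k * (n%:R * (`|x - y| / r k)) = n%:R * `|x - y| * (g k * r k ^- 1).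
    by rewrite expr1; ring.
  by rewrite ler_wpM2l ?mulr_ge0 // weight_le.
by rewrite mulrAC ler_wpM2r // lerDl.
Qed.

Lemma gen_continuous : (0 < n)%N -> continuous gen.
Proof.
move=> n0 x; have [L L0 HL] := gen_lipschitz n0.
apply/cvgrPdist_le => e e0; near=> y.
apply: (le_trans (HL x y)); rewrite -ler_pdivlMl //.
near: y; apply: (@cvgrPdist_le _ _ _ _ _ id x).1 => //.
by rewrite mulrC divr_gt0.
Unshelve. all: by end_near. Qed.

(** Markov's inequality for the radius: each tent power is at most [r k / z], and the mean radius is
    finite. *)
Lemma gen_decay : (0 < n)%N -> exists M, forall z : R, 0 < z -> gen z <= M / z.
Proof.
move=> n0; exists (rsum b) => z z0; rewrite genE mulrC -rsumZ //.
apply: ler_rsum => [||k]; [exact: gen_cvg|exact: is_cvg_seriesZ|].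
rewrite /b mulrCA (ler_wpM2l (ltW (g0 k))) //.
apply: (@le_trans _ _ (tent (r k) z)).
  have [t0 t1] := andP (tent_itv z (r0 k)).
  by case: (n) n0 => // m _; rewrite exprS ler_piMr // exprn_ile1.
apply: (le_trans (tent_decay (r0 k) z0)).
rewrite mulrC ler_wpM2l ?invr_ge0 ?(ltW z0) //.
by rewrite [1 + _]addrC -addrA lerDl addr_ge0 // invr_ge0 exprn_ge0 // ltW.
Qed.

Lemma gen_cvg0 : (0 < n)%N -> gen x @[x --> +oo] --> (0 : R).
Proof.
move=> n0; have [M HM] := gen_decay n0.
apply/cvgrPdist_le => e e0; near=> x.
have x0 : 0 < x by near: x; exact: nbhs_pinfty_gt.
rewrite sub0r normrN ger0_norm ?(ltW (gen_gt0 _ n0)) //.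
by apply: (le_trans (HM x x0)); rewrite ler_pdivrMr // mulrC -ler_pdivrMr //.
Unshelve. all: by end_near. Qed.

Lemma gen_surj t : (0 < n)%N -> 0 < t <= 1 -> exists2 z, 0 <= z & gen z = t.
Proof.
move=> n0 /andP[t0 t1]; have [M HM] := gen_decay n0.
pose z1 := Num.max 1 (M / t).
have z10 : 0 < z1 by rewrite lt_max ltr01.
have gz1 : gen z1 <= t.
  apply: (le_trans (HM _ z10)); rewrite ler_pdivrMr // mulrC -ler_pdivrMr //.
  by rewrite le_max lexx orbT.
have [] := @IVT R gen 0 z1 t (ltW z10).
- by apply: continuous_subspaceT; exact: gen_continuous.
- by rewrite (gen_neg (lexx 0)) min_r ?max_l ?gz1 ?t1 //; exact: le_trans t1.
by move=> c; rewrite in_itv /= => /andP[c0 _] ct; exists c.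
Qed.

Lemma level_inf_gen z : (0 < n)%N -> 0 <= z -> level_inf gen (gen z) = z%:E.
Proof.
move=> n0 z0; rewrite /level_inf.
have -> : [set y%:E | y in [set y | 0 <= y /\ gen y = gen z]] = [set z%:E];
  last exact: ereal_inf1.
apply/seteqP; split => [_ [y [y0 /(gen_inj n0 y0 z0) ->] <-]|_ ->] //.
by exists z.
Qed.

Lemma level_inf_gen_out t : (0 < n)%N -> ~~ (0 < t <= 1) -> level_inf gen t = +oo%E.
Proof.
move=> n0 /negP tout; rewrite /level_inf.
have -> : [set z%:E | z in [set z | 0 <= z /\ gen z = t]] = set0; last exact: ereal_inf0.
apply/seteqP; split => // _ [y [y0 yt] <-]; apply: tout.
by rewrite -yt gen_gt0 //; case/andP: (gen_itv y).
Qed.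

Lemma genK z : (0 < n)%N -> 0 <= z -> gen_inv (gen z) = z.
Proof. by move=> n0 z0; rewrite /gen_inv level_inf_gen. Qed.

Lemma gen_invK t : (0 < n)%N -> 0 < t <= 1 -> gen (gen_inv t) = t.
Proof. by move=> n0 /(gen_surj n0)[z z0 <-]; rewrite genK. Qed.

Lemma level_infE t : (0 < n)%N -> 0 < t <= 1 -> level_inf gen t = (gen_inv t)%:E.
Proof. by move=> n0 /(gen_surj n0)[z z0 <-]; rewrite genK ?level_inf_gen. Qed.

Lemma gen_inv_ge0 t : (0 < n)%N -> 0 <= gen_inv t.
Proof.
move=> n0; have [/(gen_surj n0)[z z0 <-]|] := boolP (0 < t <= 1); first by rewrite genK.
by move=> /(level_inf_gen_out n0); rewrite /gen_inv => ->.
Qed.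

Lemma gen_le_iff z t : (0 < n)%N -> 0 <= z -> 0 < t <= 1 ->
  (gen z <= t) = (gen_inv t <= z).
Proof.
move=> n0 z0 /(gen_surj n0)[y y0 <-]; rewrite genK //.
have [yz|zy] := leP y z; first exact: gen_le.
by apply/negbTE; rewrite -ltNge; exact: gen_lt.
Qed.

(** For [x >= 0] the set where the inverse exceeds [x] is the interval []0, gen x[], because the
    default value 0 never exceeds [x]; for [x < 0] it is the whole line. *)
Lemma gen_inv_measurable : (0 < n)%N -> measurable_fun setT gen_inv.
Proof.
move=> n0; apply: (measurability _ (RGenOInfty.measurableE R)) => //.
move=> _ [_ [x ->] <-]; rewrite setTI.
have [x0|x0] := ltP x 0.
  rewrite (_ : _ @^-1` _ = setT) //; apply/seteqP; split => // t _ /=.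
  by rewrite in_itv /= andbT (lt_le_trans x0) // gen_inv_ge0.
rewrite (_ : _ @^-1` _ = [set` `]0, gen x[]) //.
apply/seteqP; split => t /=; rewrite !in_itv /= andbT.
  have [t01|/(level_inf_gen_out n0)] := boolP (0 < t <= 1); last first.
    by rewrite /gen_inv => -> /= /(le_lt_trans x0); rewrite ltxx.
  rewrite ltNge -gen_le_iff // -ltNge => ->.
  by case/andP: t01 => ->.
move=> /andP[t0 tx]; have t01 : 0 < t <= 1.
  by rewrite t0 (le_trans (ltW tx)) //; case/andP: (gen_itv x).
by rewrite ltNge -gen_le_iff // -ltNge.
Qed.

Lemma gen_arch_generator : (2 <= n)%N -> gen 1 = 2^-1 -> arch_generator n.+1 gen.
Proof.
move=> n2 gen1; have n0 : (0 < n)%N by exact: ltnW.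
have dn : (n.+1 - 2 = n.-1)%N by rewrite subSS subn1.
have n1n : (n.-1 < n)%N by rewrite prednK.
(* The two alternating signs cancel, so sign, monotonicity and convexity are inherited from
   [gen_deriv n.-1]. *)
have gE x : 0 < x -> (-1) ^+ (n.+1 - 2) * derive1n (n.+1 - 2) gen x
    = (n ^_ n.-1)%:R * gen_deriv n.-1 x.
  move=> x0; rewrite dn gen_derive1n // !mulrA -expr2 sqrr_sign mul1r //.
split; split.
- by apply: continuous_subspaceT; exact: gen_continuous.
- by move=> z _; exact: gen_itv.
- by move=> x y _; exact: gen_le.
- exact: gen_neg.
- exact: gen_cvg0.
- by move=> x y x0 xy _; exact: gen_lt.
- exact: gen1.
- move=> k; rewrite dn => kn x x0; apply: gen_derivable => //.
  by rewrite addn2 -(prednK n0) ltnS.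
- by move=> x x0; rewrite gE // mulr_ge0 // gen_deriv_ge0 // leq_pred.
- move=> x y x0 xy; rewrite !gE ?(lt_le_trans x0) //.
  by rewrite ler_wpM2l // gen_deriv_le // leq_pred.
- move=> x y t x0 y0 t01.
  have xy0 : 0 < t * x + (1 - t) * y.
    case/andP: t01; rewrite le_eqVlt => /orP[/eqP <- _|t0 t1].
      by rewrite mul0r add0r subr0 mul1r.
    by rewrite ltr_pwDl ?mulr_gt0 // mulr_ge0 ?subr_ge0 // ltW.
  rewrite !gE //.
  have cvx : gen_deriv n.-1 (t * x + (1 - t) * y) <=
      t * gen_deriv n.-1 x + (1 - t) * gen_deriv n.-1 y.
    by apply: gen_deriv_convex; rewrite ?prednK // ltW.
  apply: (le_trans (ler_wpM2l _ cvx)) => //.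
  by rewrite mulrDr [X in X + _]mulrCA [X in _ + X]mulrCA.
Qed.

End generator.

(** * Measurability in R^n and uniqueness of measures on orthants *)

Section Rsp_measurability.
Variable R : realType.

Lemma measurable_coord n (i : 'I_n) : measurable_fun setT (fun x : Rsp R n => x i).
Proof.
move=> _ B mB; rewrite setTI; apply: sub_sigma_algebra; exists i, B.
by split.
Qed.

Lemma measurable_fun_Rsp d (T : measurableType d) n (f : T -> Rsp R n) :
  (forall i, measurable_fun setT (fun x => f x i)) -> measurable_fun setT f.
Proof.
move=> mf; apply: (measurability _ (erefl : @measurable _ (Rsp R n) = <<s cyl R n >>)).
move=> _ [_ [i [B [mB ->]]] <-]; exact: mf.
Qed.

Lemma measurable_forall d (T : measurableType d) n (A : 'I_n -> set T) :
  (forall i, measurable (A i)) -> measurable [set x | forall i, A i x].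
Proof.
move=> mA; rewrite (_ : [set x | _] = \bigcap_(i in [set: 'I_n]) A i).
  by apply: fin_bigcap_measurable => //; exact: finite_finset.
by apply/seteqP; split => [x Ax i _|x Ax i]; [exact: Ax|exact: (Ax i)].
Qed.

Lemma measurable_coord_set n (i : 'I_n) (B : set R) : measurable B ->
  measurable ([set x | B (x i)] : set (Rsp R n)).
Proof. by move=> mB; have := measurable_coord i measurableT mB; rewrite setTI. Qed.

Lemma measurable_coords n (B : 'I_n -> set R) : (forall i, measurable (B i)) ->
  measurable ([set x | forall i, B i (x i)] : set (Rsp R n)).
Proof. by move=> mB; apply: measurable_forall => i; exact: measurable_coord_set. Qed.

Lemma measurable_coord_sum n (f : R -> R) : measurable_fun setT f ->
  measurable_fun setT (fun x : Rsp R n => \sum_i f (x i)).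
Proof.
move=> mf; apply: (@measurable_sum _ _ _ _ _ _ (fun i (x : Rsp R n) => f (x i))).
by move=> i; apply: measurableT_comp => //; exact: measurable_coord.
Qed.

Lemma measurable_initc n : measurable_fun setT (@initc R n : Rsp R n.+1 -> Rsp R n).
Proof. by apply: measurable_fun_Rsp => i; exact: measurable_coord. Qed.

Lemma measurable_preim d d' (T : measurableType d) (T' : measurableType d')
  (f : T -> T') A : measurable_fun setT f -> measurable A -> measurable (f @^-1` A).
Proof. by move=> mf mA; rewrite -[X in measurable X]setTI; exact: mf. Qed.

(* The orthants [v <= a] form a generating pi-system. *)
Lemma Rsp_measure_unique n (m1 m2 : {measure set (Rsp R n) -> \bar R}) :
  (forall a : 'I_n -> R, m1 [set v | forall i, v i <= a i] =
                         m2 [set v | forall i, v i <= a i]) ->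
  (m1 setT < +oo)%E -> forall A, measurable A -> m1 A = m2 A.
Proof.
move=> m12 m1T.
pose G : set (set (Rsp R n)) := [set A | exists a : 'I_n -> R,
  A = [set v | forall i, v i <= a i]].
pose g (k : nat) : set (Rsp R n) := [set v | forall i, v i <= k%:R].
have Gg k : G (g k) by exists (fun=> k%:R).
have gT : \bigcup_k g k = setT.
  apply/seteqP; split => // v _.
  exists (\max_(i < n) (Num.truncn `|v i|).+1) => // i.
  rewrite /g /=; apply: (le_trans (ler_norm _)).
  apply: (le_trans (ltW (truncnS_gt _))).
  by rewrite ler_nat (leq_bigmax i).
have mG : @measurable _ (Rsp R n) = <<s G >>.
  apply/seteqP; split; last first.
    apply: smallest_sub; first exact: sigma_algebra_measurable.
    move=> _ [a ->]; apply: (@measurable_coords _ (fun i => [set z | z <= a i])) => i.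
    by have := @measurable_itv R `]-oo, a i]; rewrite set_itvE.
  apply: smallest_sub; first exact: smallest_sigma_algebra.
  move=> _ [i [B [mB ->]]].
  suff mi : measurable_fun setT (fun x : g_sigma_algebraType G => (x : Rsp R n) i).
    by have := mi measurableT _ mB; rewrite setTI.
  apply: (measurability _ (RGenOInfty.measurableE R)) => //.
  move=> _ [_ [y ->] <-]; rewrite setTI.
  (* The half-space below [y] in coordinate [i] is exhausted by orthants whose other bounds [k] tend
     to infinity. *)
  rewrite (_ : _ @^-1` _ = ~` \bigcup_k ([set v | forall j, v j <= if j == i then y else k%:R]
     : set (g_sigma_algebraType G))).
    apply: measurableC; apply: bigcupT_measurable => k.
    by apply: sub_sigma_algebra; exists (fun j => if j == i then y else k%:R).
  apply/seteqP; split => v /=; rewrite in_itv /= andbT.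
    by move=> yv [k _ /(_ i)]; rewrite eqxx leNgt yv.
  move=> H; rewrite ltNge; apply/negP => vy; apply: H.
  have [k _ gk] : (\bigcup_k g k) v by rewrite gT.
  by exists k => // j; case: eqVneq => [->|_] //; exact: gk.
apply: (measure_unique G g) => //.
- move=> _ _ [a ->] [b ->]; exists (fun i => Num.min (a i) (b i)).
  apply/seteqP; split => v /=.
    by move=> [va vb] i; rewrite le_min va vb.
  by move=> vab; split => i; have := vab i; rewrite le_min => /andP[].
- by move=> _ [a ->].
- move=> k; apply: le_lt_trans m1T; apply: le_measure; rewrite ?inE //.
  by rewrite mG; apply: sub_sigma_algebra; exact: Gg.
Qed.

End Rsp_measurability.

(** * Pushforwards, mixtures and products as bare existence statements *)

Section measure_constructions.
Local Open Scope ereal_scope.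

Lemma pushforward_exists d d' (T : measurableType d) (T' : measurableType d')
    (R : realType) (m : {measure set T -> \bar R}) (f : T -> T') :
  measurable_fun setT f ->
  exists m' : {measure set T' -> \bar R}, forall A, m' A = m (f @^-1` A).
Proof.
move=> mf; pose m' : {measure set T' -> \bar R} :=
  measure_function_pushforward__canonical__measure_function_Measure m mf.
by exists m'.
Qed.

Lemma ge0_integral_mrestr d (T : measurableType d) (R : realType)
    (m : {measure set T -> \bar R}) (D A : set T) (mD : measurable D) f :
  measurable A -> measurable_fun setT f -> (forall x, 0 <= f x) ->
  \int[mrestr m mD]_(x in A) f x = \int[m]_(x in A `&` D) f x.
Proof.
move=> mA mf f0.
have mAD := measurableI _ _ mA mD; have mAD' := measurableD mA mD.
rewrite -[in LHS](setUIDK A D) setUC ge0_integral_setU //; first last.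
- rewrite disj_set2E; apply/eqP/seteqP; split => // x.
  by move=> [[_ nD] [_ /nD]].
- exact: measurable_funTS.
rewrite [X in X + _](eq_measure_integral mzero) ?integral_measure_zero ?add0e.
  apply: eq_measure_integral => B mB BAD; rewrite /= /mrestr setIidl //.
  by move=> x /BAD[].
move=> B mB BAD; rewrite /= /mrestr (_ : B `&` D = set0) ?measure0 //.
by apply/seteqP; split => // x [/BAD[]].
Qed.

(** A series of scaled pushforwards of restrictions of [l]. It yields the copula measure, its
    marginal (which needs the integral formula) and later a discrete law on the line. *)
Lemma mixture_exists d d' (T : measurableType d) (T' : measurableType d')
    (R : realType) (l : {measure set T -> \bar R}) (D : nat -> set T)
    (c : nat -> R) (G : nat -> T -> T') :
  (forall k, measurable (D k)) -> (forall k, (0 <= c k)%R) ->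
  (forall k, measurable_fun setT (G k)) ->
  exists m : {measure set T' -> \bar R},
    (forall A, m A = \sum_(k <oo) (c k)%:E * l (G k @^-1` A `&` D k)) /\
    (forall (f : T' -> \bar R) A, measurable A -> measurable_fun setT f ->
      (forall x, 0 <= f x) ->
      \int[m]_(x in A) f x =
      \sum_(k <oo) (c k)%:E * \int[l]_(x in G k @^-1` A `&` D k) f (G k x)).
Proof.
move=> mD c0 mG.
pose mr k : {measure set T -> \bar R} := mrestr l (mD k).
pose mp k : {measure set T' -> \bar R} :=
  measure_function_pushforward__canonical__measure_function_Measure (mr k) (mG k).
pose ms k : {measure set T' -> \bar R} := mscale (NngNum (c0 k)) (mp k).
exists (mseries ms 0); split => // f A mA mf f0.
rewrite ge0_integral_measure_series //; last exact: measurable_funTS.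
apply: eq_eseriesr => k _.
rewrite ge0_integral_mscale //; last exact: measurable_funTS.
congr (_ * _); rewrite /mp /=.
rewrite ge0_integral_pushforward //; last exact: measurable_funTS.
rewrite ge0_integral_mrestr //; first exact: measurable_preim.
  exact: measurableT_comp.
by move=> x; exact: f0.
Qed.

End measure_constructions.

Section sigma_finite_packing.
Context d (T : measurableType d) (R : realType) (l : {measure set T -> \bar R}).

(** An alias of [l] that carries the hypothesis as an argument, so that a canonical instance can
    depend on it. *)
Definition as_sigma_finite of sigma_finite setT l : set T -> \bar R := l.

Hypothesis sf : sigma_finite setT l.

HB.instance Definition _ := Measure.copy (as_sigma_finite sf) l.
HB.instance Definition _ :=
  Measure_isSigmaFinite.Build _ _ _ (as_sigma_finite sf) sf.

Lemma sigma_finite_measure_exists :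
  exists l' : {sigma_finite_measure set T -> \bar R}, forall A, l' A = l A.
Proof. by exists (as_sigma_finite sf). Qed.

End sigma_finite_packing.

Lemma product_sigma_finite_exists d d' (T : measurableType d)
    (T' : measurableType d') (R : realType)
    (m1 : {sigma_finite_measure set T -> \bar R})
    (m2 : {sigma_finite_measure set T' -> \bar R}) :
  exists m : {measure set (T * T')%type -> \bar R},
    sigma_finite setT m /\ forall A, m A = (\int[m1]_x m2 (xsection A x))%E.
Proof.
pose m : {measure set (T * T')%type -> \bar R} := (m1 \x m2)%E.
exists m; split => //.
(* Increasing exhaustions are chosen so that a pair lying in [F i] and [G j] lies in the rectangle
   of index [maxn i j]. *)
have /sigma_finiteP[F [TF ndF Foo]] := sigma_finiteT m1.
have /sigma_finiteP[G [TG ndG Goo]] := sigma_finiteT m2.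
exists (fun n => F n `*` G n).
  apply/seteqP; split => // -[x y] _.
  have [i _ Fx] : (\bigcup_i F i) x by rewrite -TF.
  have [j _ Gy] : (\bigcup_i G i) y by rewrite -TG.
  exists (maxn i j) => //; split => /=.
    by move: x Fx; exact/subsetPset/ndF/leq_maxl.
  by move: y Gy; exact/subsetPset/ndG/leq_maxr.
move=> k; have [mF Fk] := Foo k; have [mG Gk] := Goo k.
split; first exact: measurableX.
by rewrite /m /= product_measure1E // lte_mul_pinfty // ge0_fin_numE.
Qed.

(** * Lebesgue measure on R^n through volumes of corner simplices *)

Section simplex.
Variable R : realType.

(** The corner [a] is left free because boxes below a point of the cube pull back to simplices of
    this shape. *)
Definition simplex n (a : 'I_n -> R) (s : R) : set ('I_n -> R) :=
  [set x | (forall i, a i <= x i) /\ \sum_i x i <= s].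

Lemma measurable_simplex n (a : 'I_n -> R) s :
  measurable (simplex a s : set (Rsp R n)).
Proof.
rewrite /simplex; apply: (@measurableI _ (Rsp R n)).
  apply: (@measurable_coords _ _ (fun i => [set z | a i <= z])) => i.
  by have := @measurable_itv R `[a i, +oo[; rewrite set_itvE.
have := @measurable_preim _ _ (Rsp R n) R _ `]-oo, s]%classic
  (@measurable_coord_sum R n id (@measurable_id _ _ _)).
rewrite (_ : _ @^-1` _ = [set x | \sum_i x i <= s]); first by apply.
by apply/seteqP; split => x /=; rewrite in_itv.
Qed.

Definition cons_fun n (p : measurableTypeR R * Rsp R n) : Rsp R n.+1 :=
  fun i => if unlift ord0 i is Some j then p.2 j else p.1.

Lemma cons_fun0 n p : @cons_fun n p ord0 = p.1.
Proof. by rewrite /cons_fun unlift_none. Qed.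

Lemma cons_funS n p i : @cons_fun n p (lift ord0 i) = p.2 i.
Proof. by rewrite /cons_fun liftK. Qed.

Lemma measurable_cons_fun n : measurable_fun setT (@cons_fun n).
Proof.
apply: measurable_fun_Rsp => i; rewrite /cons_fun; case: unliftP => [j _|_].
  exact: (measurableT_comp (measurable_coord j) measurable_snd).
exact: measurable_fst.
Qed.

Lemma measurable_uncons n :
  measurable_fun setT (fun x : Rsp R n.+1 => (x ord0, (fun j => x (lift ord0 j)) : Rsp R n)).
Proof.
apply: measurable_fun_pair; first exact: measurable_coord.
by apply: measurable_fun_Rsp => j; exact: measurable_coord.
Qed.

(** One Fubini step of the volume formula: [t] is the first coordinate and [A] the sum of the other
    corner coordinates. The antiderivative [F] vanishes at the upper end [s - A]. *)
Lemma integral_simplex_section n (a0 A s : R) :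
  (\int[lebesgue_measure]_t (if ((a0 <= t) && (A <= s - t))%R
      then ((s - t - A) ^+ n / n`!%:R)%:E else 0) =
   if (a0 + A <= s)%R then ((s - (a0 + A)) ^+ n.+1 / n.+1`!%:R)%:E else 0)%E.
Proof.
pose f t : R := (s - t - A) ^+ n / n`!%:R.
pose F t : R := - ((s - t - A) ^+ n.+1 / n.+1`!%:R).
have d1 (t : R) : is_derive t 1 (fun u : R => s - u - A) (-1).
  apply: (@is_derive_eq _ _ _ _ _ _ _ _ (is_deriveB (is_deriveB
    (is_derive_cst s t 1) (is_derive_id t 1)) (is_derive_cst A t 1))).
  by rewrite subr0 sub0r.
have dF (t : R) : is_derive t 1 F (f t).
  have -> : F = (- n.+1`!%:R^-1) *: (fun u : R => s - u - A) ^+ n.+1.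
    rewrite exprfctE scalrfctE; apply/funext => u.
    by rewrite /F /GRing.scale /= mulNr mulrC.
  apply: is_derive_eq; rewrite /f /GRing.scale /= factS natrM.
  field.
  by rewrite pnatr_eq0 -lt0n fact_gt0 nat1r pnatr_eq0.
have cf : continuous f.
  have -> : f = n`!%:R^-1 *: (fun u : R => s - u - A) ^+ n.
    rewrite exprfctE scalrfctE; apply/funext => u.
    by rewrite /f /GRing.scale /= mulrC.
  move=> t; apply: differentiable_continuous; apply/derivable1_diffP.
  exact: ex_derive.
have cF : continuous F.
  move=> t; apply: differentiable_continuous.
  by apply/derivable1_diffP; apply: ex_derive.
transitivity (\int[lebesgue_measure]_(t in `[a0, (s - A)%R]) (f t)%:E)%E.
  rewrite [RHS]integral_mkcond; apply: eq_integral => t _.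
  rewrite patchE mem_setE in_itv /=.
  by have -> : (A <= s - t) = (t <= s - A) by rewrite lerBrDr addrC -lerBrDr.
have [lt|gt|e] := ltgtP (a0 + A) s.
- rewrite (@continuous_FTC2 _ f F) //.
  + rewrite /F -EFinB; congr EFin.
    have -> : s - (s - A) - A = 0 by ring.
    rewrite expr0n /= mul0r oppr0 sub0r opprK; congr (_ ^+ _ / _); ring.
  + by rewrite ltrBrDr.
  + exact: continuous_subspaceT.
  + split.
    * by move=> t _; apply: ex_derive.
    * by apply: cvg_at_right_filter; exact: cF.
    * by apply: cvg_at_left_filter; exact: cF.
  + by move=> t _; rewrite derive1E derive_val.
- by rewrite set_itv_ge ?integral_set0 // bnd_simp -ltNge ltrBlDr.
- have -> : s - A = a0 by rewrite -e addrK.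
  by rewrite set_itv1 integral_set1 e subrr expr0n mul0r.
Qed.

(** Induction on the dimension by products with the line. Sigma-finiteness is carried along because
    the next product requires it. *)
Lemma lebesgue_Rsp_exists n : exists l : {measure set (Rsp R n) -> \bar R},
  sigma_finite setT l /\
  forall a s, l (simplex a s) =
    (if (\sum_i a i <= s)%R then ((s - \sum_i a i) ^+ n / n`!%:R)%:E else 0)%E.
Proof.
elim: n => [|n [l [sf lE]]].
  (* In dimension 0 there is a single point, and the volume formula reads 1 exactly when
     [0 <= s]. *)
  exists \d_(point : Rsp R 0); split.
    exact: (@sigma_finiteT _ _ _ \d_(point : Rsp R 0)).
  move=> a s; rewrite big_ord0 expr0 fact0 divr1 /= diracE.
  case: ifPn => s0.
    by rewrite mem_set //; split; [case|rewrite big_ord0].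
  by rewrite memNset //= => -[_]; rewrite big_ord0; exact/negP.
have [l' l'E] := sigma_finite_measure_exists sf.
have [m [msf mE]] := product_sigma_finite_exists
  (lebesgue_measure : {sigma_finite_measure set (measurableTypeR R) -> \bar R}) l'.
have [m' m'E] := pushforward_exists m (@measurable_cons_fun n).
exists m'; split.
  have [F FT Foo] := msf.
  pose un := (fun x : Rsp R n.+1 => (x ord0, (fun j => x (lift ord0 j)) : Rsp R n)).
  have unK p : un (cons_fun p) = p.
    case: p => t x; rewrite /un cons_fun0; congr pair.
    by apply/funext => j; rewrite cons_funS.
  exists (fun k => un @^-1` F k).
    by rewrite -preimage_bigcup -FT preimage_setT.
  move=> k; have [mF Fk] := Foo k; split.
    by apply: measurable_preim => //; exact: measurable_uncons.
  rewrite m'E -comp_preimage (_ : un \o _ = id) //.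
  by apply/funext => p; exact: unK.
move=> a s; rewrite m'E mE.
pose a' : 'I_n -> R := fun j => a (lift ord0 j).
rewrite big_ord_recl -integral_simplex_section; apply: eq_integral => t _.
have [at_|at_] /= := leP (a ord0) t; last first.
  rewrite (_ : xsection _ _ = set0) ?measure0 //.
  apply/seteqP; split => // x; rewrite /xsection /= inE => -[/(_ ord0)].
  by rewrite cons_fun0 /= leNgt at_.
rewrite -lE l'E; congr (l _); apply/seteqP; split => x; rewrite /xsection /= inE /simplex /=.
  rewrite big_ord_recl cons_fun0 /= => -[ax xs]; split.
    by move=> j; have := ax (lift ord0 j); rewrite cons_funS.
  by rewrite lerBrDl; under eq_bigr do rewrite -[x _](@cons_funS n (t, x)).
move=> [ax xs]; split.
  move=> i; case: (unliftP ord0 i) => [j ->|->]; first by rewrite cons_funS; exact: ax.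
  by rewrite cons_fun0.
by rewrite big_ord_recl cons_fun0 /=; under eq_bigr do rewrite cons_funS; rewrite -lerBrDl.
Qed.

End simplex.

(** Common criterion for the Kendall and the conditional distribution functions. The set [D]
    discards the radii that are impossible under the conditioning; a jump in every interval gives
    strict growth. *)
Lemma discrete_df_step (R : realType) (F : R -> R) (p w : nat -> R) (D : set nat) :
  (forall k, 0 <= w k) -> cvgn (series w) ->
  (forall i j, D i -> D j -> p i = p j -> i = j) ->
  (forall k, D k -> 0 <= p k <= 1) ->
  (forall x y, 0 <= x -> x < y -> y <= 1 ->
     exists k, [/\ D k, x < p k, p k <= y & 0 < w k]) ->
  (forall y, 0 <= y <= 1 ->
     F y = rsum (fun k => if (k \in D) && (p k <= y) then w k else 0)) ->
  strict_incr_step F.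
Proof.
move=> w0 cw pinj p01 pdense FE.
have cF y : cvgn (series (fun k => if (k \in D) && (p k <= y) then w k else 0)).
  apply: (series_dominated_cvg cw (M := 1)) => k; rewrite mul1r.
  by case: ifP => _; rewrite ?normr0 // ger0_norm.
split.
  move=> x y x0 xy y1.
  rewrite !FE ?x0 ?y1 ?(le_trans (ltW xy)) ?(le_trans x0 (ltW xy)) //.
  apply: ltr_rsum => // [k|].
    case: (k \in D) => //=; case: ifPn => [px|_]; last by case: ifP.
    by rewrite (le_trans px) // ltW.
  have [k [Dk xp py wk]] := pdense x y x0 xy y1.
  by exists k; rewrite mem_set //= py leNgt xp.
(* A jump point determines its index by injectivity on [D]; any other point receives [w 0], which is
   still nonnegative. *)
exists (p @` D), (fun s => w (xget 0%N [set k | D k /\ p k = s])); split.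
- apply: (sub_countable (card_image_le _ _)); exact: countableP.
- by move=> _ [k Dk <-]; exact: p01.
- by [].
- move=> y y01; rewrite FE // -rsumE //.
  rewrite nneseries_esumT; last first.
    by move=> k; rewrite lee_fin; case: ifP => _; [exact: w0|].
  have bij : set_bij [set k | D k /\ p k <= y] [set s | (p @` D) s /\ s <= y] p.
    split.
    - by move=> k [Dk py]; split => //; exists k.
    - by move=> i j; rewrite !inE => -[Di _] [Dj _]; exact: pinj.
    - by move=> s [[k Dk <-] py]; exists k.
  rewrite (@reindex_esum _ _ _ _ _ _ _ bij) [RHS]esum_mkcond; apply: eq_esum => k _.
  have -> : (k \in [set k | D k /\ p k <= y]) = (k \in D) && (p k <= y).
    apply/idP/andP; first by rewrite inE => -[Dk py]; split => //; exact/mem_set.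
    by move=> [/set_mem Dk py]; rewrite inE.
  case: ifPn => // /andP[/set_mem Dk py]; congr (w _)%:E.
  by case: xgetP => [i -> [Di pi]|/(_ k)[]] //; exact: pinj.
Qed.

Section probability_packing.
Context d (T : measurableType d) (R : realType) (m : {measure set T -> \bar R}).

Definition as_probability of m setT = 1%E : set T -> \bar R := m.

Hypothesis mT : m setT = 1%E.

HB.instance Definition _ := Measure.copy (as_probability mT) m.
HB.instance Definition _ :=
  Measure_isProbability.Build _ _ _ (as_probability mT) mT.

Lemma probability_exists : exists P : probability T R, forall A, P A = m A.
Proof. by exists (as_probability mT). Qed.

End probability_packing.

(** * A copula determines its measure *)

Section copula_uniqueness.
Variables (R : realType) (d : nat) (C : ('I_d -> R) -> R).

Lemma measurable_cube : measurable (cube R d : set (Rsp R d)).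
Proof.
apply: (@measurable_coords _ _ (fun=> [set z | 0 <= z <= 1])) => i.
by have := @measurable_itv R `[0, 1]; rewrite set_itvE.
Qed.

Lemma copula_measureI (mu : probability (Rsp R d) R) (A : set (Rsp R d)) :
  copula_measure C mu -> measurable A -> mu A = mu (A `&` cube R d).
Proof.
move=> [mu1 _] mA; apply/eqP; rewrite eq_le; apply/andP; split; last first.
  apply: le_measure; rewrite ?inE //.
  by apply: measurableI => //; exact measurable_cube.
have mC : measurable (~` (cube R d) : set (Rsp R d)) by apply: measurableC; exact measurable_cube.
have muC : mu (~` (cube R d) : set (Rsp R d)) = 0%E.
  by rewrite probability_setC ?mu1 ?subee //; exact measurable_cube.
have mAC : measurable (A `&` cube R d) by apply: measurableI => //; exact measurable_cube.
apply: (@le_trans _ _ (mu ((A `&` cube R d) `|` ~` cube R d))).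
  apply: le_measure; rewrite ?inE //; first exact: measurableU.
  by move=> x Ax; have [cx|cx] := pselect (cube R d x); [left|right].
have : (mu ((A `&` cube R d) `|` ~` cube R d) <=
    mu (A `&` cube R d) + mu (~` cube R d))%E by exact: measureU2.
by rewrite muC adde0.
Qed.

(** Orthants determine a finite measure. Inside the cube the orthant below [a] is the box below
    [min(a, 1)], whose mass is prescribed, or it is empty if some [a i] is negative. *)
Lemma copula_measure_unique (mu mu' : probability (Rsp R d) R) :
  copula_measure C mu -> copula_measure C mu' ->
  forall A, measurable A -> mu A = mu' A.
Proof.
move=> cmu cmu'; apply: Rsp_measure_unique => [a|]; last first.
  by rewrite -ge0_fin_numE //; exact: fin_num_measure.
have ma : measurable ([set v | forall i, v i <= a i] : set (Rsp R d)).
  apply: (@measurable_coords _ _ (fun i => [set z | z <= a i])) => i.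
  by have := @measurable_itv R `]-oo, a i]; rewrite set_itvE.
rewrite [LHS](copula_measureI cmu) // [RHS](copula_measureI cmu') //.
have [a0|/existsNP[i /negP ai]] := pselect (forall i, 0 <= a i).
  pose b i := Num.min (a i) 1.
  rewrite (_ : _ `&` _ = box0 b).
    have cb : cube R d b by move=> i; rewrite /b le_min a0 ler01 ge_min lexx orbT.
    by rewrite cmu.2 // cmu'.2.
  apply/seteqP; split => v.
    by move=> [va cv] i; case/andP: (cv i) => v0 v1; rewrite v0 le_min va v1.
  move=> bv; split => i; have /andP[v0] := bv i; rewrite le_min => /andP[va v1] //.
  by rewrite v0.
rewrite (_ : _ `&` _ = set0) ?measure0 //.
apply/seteqP; split => // v [va /(_ i)/andP[v0 _]]; apply: (negP ai).
exact: le_trans (va i).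
Qed.

End copula_uniqueness.

(** * Evaluation and measurability of the Archimedean copula *)

Section arch_formula.
Variables (R : realType) (n : nat) (r g : nat -> R).
Hypotheses (mw : mixing_weights n r g) (n0 : (0 < n)%N).
Let psi := gen n r g.
Let phi := gen_inv n r g.

Definition inv_sum d (u : 'I_d -> R) : R := \sum_i phi (u i).

Lemma arch_copula_pos d (u : 'I_d -> R) : (forall i, 0 < u i <= 1) ->
  arch_copula psi u = psi (inv_sum u).
Proof.
move=> u01; rewrite /arch_copula.
under eq_bigr do rewrite /Defs.pinv (level_infE mw n0) //.
by rewrite sumEFin.
Qed.

(** The generator is positive, so the pseudo-inverse of [u i] is [+oo]; no summand is [-oo], hence
    the whole sum is [+oo], where [psiE] is 0. *)
Lemma arch_copula_eq0 d (u : 'I_d -> R) i : u i <= 0 -> arch_copula psi u = 0.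
Proof.
move=> ui; rewrite /arch_copula (bigD1 i) //=.
rewrite {1}/Defs.pinv (level_inf_gen_out mw n0); last by rewrite ltNge ui.
rewrite addye //; apply/negP => /eqP/esum_eqNyP[j [_ _]].
rewrite /Defs.pinv; have [uj|uj] := boolP (0 < u j <= 1).
  by rewrite (level_infE mw n0).
by rewrite (level_inf_gen_out mw n0).
Qed.

Lemma measurable_inv_sum d : measurable_fun setT (@inv_sum d : Rsp R d -> R).
Proof. by apply: measurable_coord_sum; exact: (gen_inv_measurable mw). Qed.

Lemma measurable_gen : measurable_fun setT psi.
Proof. by apply: continuous_measurable_fun; exact: (gen_continuous mw n0). Qed.

(** The formula through [inv_sum] holds where all coordinates are positive. On the rest of the cube
    the copula is 0, so the proof splits on whether [B] contains 0. *)
Lemma measurable_arch_level d (B : set R) : measurable B ->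
  measurable ([set u | cube R d u /\ B (arch_copula psi u)] : set (Rsp R d)).
Proof.
move=> mB; pose P : set (Rsp R d) := [set u | forall i, 0 < u i <= 1].
have mP : measurable P.
  apply: (@measurable_coords _ _ (fun=> [set z | 0 < z <= 1])) => i.
  by have := @measurable_itv R `]0, 1]; rewrite set_itvE.
have mcube : measurable (cube R d : set (Rsp R d)) := @measurable_cube R d.
have mS : measurable (P `&` (psi \o @inv_sum d) @^-1` B).
  apply: measurableI => //.
  exact: (measurable_preim (measurableT_comp measurable_gen (@measurable_inv_sum d)) mB).
have subP u : cube R d u -> ~ P u -> arch_copula psi u = 0.
  move=> cu /existsNP[i Pi]; apply: (@arch_copula_eq0 _ _ i).
  by have /andP[u0 u1] := cu i; rewrite leNgt; apply/negP => u0'; apply: Pi; rewrite u0'.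
have subC u : P u -> cube R d u.
  by move=> Pu i; have /andP[/ltW -> ->] := Pu i.
have [B0|B0] := pselect (B 0).
  rewrite (_ : [set u | _] = (P `&` (psi \o @inv_sum d) @^-1` B) `|` (cube R d `\` P)).
    by apply: measurableU => //; exact: measurableD.
  apply/seteqP; split => u.
    move=> [cu Bu]; have [Pu|Pu] := pselect (P u); last by right.
    by left; split => //=; rewrite -arch_copula_pos.
  move=> [[Pu Bu]|[cu Pu]]; split => //; first exact: subC.
    by rewrite arch_copula_pos.
  by rewrite subP.
rewrite (_ : [set u | _] = (P `&` (psi \o @inv_sum d) @^-1` B)) //.
apply/seteqP; split => u.
  move=> [cu Bu]; have [Pu|Pu] := pselect (P u).
    by split => //=; rewrite -arch_copula_pos.
  by move: Bu; rewrite subP.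
by move=> [Pu Bu]; split; [exact: subC|rewrite arch_copula_pos].
Qed.

End arch_formula.

(** * The mixture law and its distribution function *)

Section mixture_copula.
Variables (R : realType) (n : nat) (r g : nat -> R).
Hypotheses (mw : mixing_weights n r g) (n0 : (0 < n)%N).
Let psi := gen n r g.
Let phi := gen_inv n r g.
Variable l : {measure set (Rsp R n) -> \bar R}.
Hypothesis lE : forall a s, l (simplex a s) =
  (if (\sum_i a i <= s)%R then ((s - \sum_i a i) ^+ n / n`!%:R)%:E else 0)%E.

Let r0 := mw_r_gt0 mw.
Let g0 := mw_g_gt0 mw.

Definition coef k : R := g k * n`!%:R / r k ^+ n.
Definition dom k : set (Rsp R n) := simplex (fun=> 0) (r k).
Definition emb k (x : Rsp R n) : Rsp R n.+1 :=
  fun i => if unlift ord_max i is Some j then psi (x j) else psi (r k - \sum_i x i).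
Definition emb0 (x : Rsp R n) : Rsp R n := fun j => psi (x j).
(* The law of (psi (r_k S_1), ..., psi (r_k S_n+1)) averaged over k with
   weights g_k, where S is uniform on the unit simplex: the first n coordinates
   of r_k S have density n! / r_k^n on [dom k]. *)
Definition mix (A : set (Rsp R n.+1)) : \bar R :=
  (\sum_(k <oo) (coef k)%:E * l (emb k @^-1` A `&` dom k))%E.

Lemma widen_lift (j : 'I_n) : widen_ord (leqnSn n) j = lift ord_max j.
Proof. by apply: val_inj; rewrite /= /bump leqNgt ltn_ord. Qed.

Lemma emb_max k x : emb k x ord_max = psi (r k - \sum_i x i).
Proof. by rewrite /emb unlift_none. Qed.

Lemma emb_lift k x j : emb k x (lift ord_max j) = psi (x j).
Proof. by rewrite /emb liftK. Qed.

Lemma initc_emb k x : initc (emb k x) = emb0 x.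
Proof. by apply/funext => j; rewrite /initc widen_lift emb_lift. Qed.

Lemma measurable_emb0 : measurable_fun setT emb0.
Proof.
apply: measurable_fun_Rsp => j.
exact: (measurableT_comp (measurable_gen mw n0) (measurable_coord j)).
Qed.

Lemma measurable_emb k : measurable_fun setT (emb k).
Proof.
apply: measurable_fun_Rsp => i; rewrite /emb; case: unliftP => [j _|_].
  exact: (measurableT_comp (measurable_gen mw n0) (measurable_coord j)).
apply: (measurableT_comp (measurable_gen mw n0)).
apply: measurable_funB; first exact: measurable_cst.
exact: (@measurable_coord_sum R n id (@measurable_id _ _ _)).
Qed.

Lemma measurable_dom k : measurable (dom k).
Proof. exact: measurable_simplex. Qed.

Lemma coef_gt0 k : 0 < coef k.
Proof. by rewrite /coef divr_gt0 ?exprn_gt0 // mulr_gt0 // ltr0n fact_gt0. Qed.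

Lemma coef_cvg : cvgn (series coef).
Proof.
rewrite (_ : coef = fun k => n`!%:R * (g k * r k ^- n)).
  by apply: is_cvg_seriesZ; exact: (weight_cvg mw).
by apply/funext => k; rewrite /coef mulrAC mulrC.
Qed.

(** The source of the Williamson transform: n! cancels between density and volume, leaving the n-th
    power of the ratio (r_k - b - sum a) / r_k, which is the tent. *)
Lemma coef_simplex k a b : 0 <= \sum_i a i + b ->
  ((coef k)%:E * l (simplex a (r k - b)) =
   (g k * tent (r k) (\sum_i a i + b) ^+ n)%:E)%E.
Proof.
set S := \sum_i a i => S0; rewrite lE -/S.
have -> : (S <= r k - b) = (S + b <= r k) by rewrite lerBrDr.
case: ifPn => [Sr|]; last first.
  rewrite -ltNge => /ltW rS; rewrite mule0 tent_eq0 //.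
  by rewrite expr0n gtn_eqF // mulr0.
rewrite -EFinM tent_pos //; congr EFin.
have -> : 1 - (S + b) / r k = (r k - b - S) / r k.
  by field; rewrite gt_eqF.
rewrite /coef expr_div_n; field.
by rewrite expf_neq0 ?gt_eqF //= pnatr_eq0 -lt0n fact_gt0.
Qed.

Lemma coef_dom k : ((coef k)%:E * l (dom k) = (g k)%:E)%E.
Proof.
have := @coef_simplex k (fun=> 0) 0; rewrite big1 // addr0 subr0 => -> //.
by rewrite tent_neg // expr1n mulr1.
Qed.

Lemma dom_sum_itv k x : dom k x -> 0 <= \sum_i x i <= r k.
Proof. by move=> [x0 ->]; rewrite sumr_ge0. Qed.

Lemma emb_itv k x i : 0 < emb k x i <= 1.
Proof.
by rewrite /emb; case: unlift => [j|]; rewrite (gen_gt0 mw _ n0) /=;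
  [have /andP[] := gen_itv mw (x j)|have /andP[] := gen_itv mw (r k - \sum_i x i)].
Qed.

Lemma inv_sum_emb k x : dom k x -> inv_sum n r g (emb k x) = r k.
Proof.
move=> Dx; have /andP[s0 sr] := dom_sum_itv Dx; case: Dx => x0 _.
rewrite /inv_sum big_ord_recr /= emb_max genK ?subr_ge0 //.
under eq_bigr do rewrite widen_lift emb_lift genK //.
by rewrite addrC subrK.
Qed.

Lemma inv_sum_emb0 x : (forall i, 0 <= x i) -> inv_sum n r g (emb0 x) = \sum_i x i.
Proof. by move=> x0; rewrite /inv_sum; under eq_bigr do rewrite /emb0 genK //. Qed.

Lemma arch_emb k x : dom k x -> arch_copula psi (emb k x) = psi (r k).
Proof.
by move=> Dx; rewrite (arch_copula_pos mw) ?inv_sum_emb // => i; exact: emb_itv.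
Qed.

Lemma cube_emb k x : cube R n.+1 (emb k x).
Proof. by move=> i; have /andP[/ltW -> ->] := emb_itv k x i. Qed.

(** The copula is constant on the image of [dom k], so each component counts with its full weight
    [g k] or not at all. *)
Lemma mix_level (B : set R) :
  mix [set u | cube R n.+1 u /\ B (arch_copula psi u)] =
  (rsum (fun k => if psi (r k) \in B then g k else 0))%:E.
Proof.
rewrite -rsumE; last first.
  apply: (series_dominated_cvg (mw_cvg_g mw) (M := 1)) => k.
  by rewrite mul1r; case: ifP => _; [rewrite gtr0_norm|rewrite normr0 ltW].
rewrite /mix; apply: eq_eseriesr => k _.
case: ifPn => [/set_mem Bk|/negP Bk].
  rewrite -coef_dom; congr (_ * l _)%E; apply/seteqP; split => x; first by case.
  by move=> Dx; split => //; split; [exact: cube_emb|rewrite arch_emb].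
rewrite (_ : _ `&` _ = set0) ?measure0 ?mule0 //.
apply/seteqP; split => // x [[_ /=]] Bx Dx; apply: Bk; apply/mem_set.
by rewrite -(arch_emb Dx).
Qed.

Lemma mix_setT : mix setT = 1%E.
Proof.
rewrite -[RHS](congr1 EFin (mw_sum1 mw)) -rsumE; last exact: mw_cvg_g mw.
rewrite /mix; apply: eq_eseriesr => k _.
by rewrite preimage_setT setTI coef_dom.
Qed.

(** The box below [u] pulls back to the simplex with corner [a] and bound [r k - b], whose mass is
    the k-th summand of psi at the sum of the inverses. If a coordinate of [u] is 0 both sides
    vanish, as [emb] has positive coordinates. *)
Lemma mix_cdf u : cube R n.+1 u -> mix (box0 u) = (arch_copula psi u)%:E.
Proof.
move=> cu.
have [u0|/existsNP[i ui]] := pselect (forall i, 0 < u i); last first.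
  rewrite (arch_copula_eq0 mw n0 (i := i)); last by rewrite leNgt; exact/negP.
  rewrite /mix eseries0 // => k _ _.
  rewrite (_ : _ `&` _ = set0) ?measure0 ?mule0 //.
  apply/seteqP; split => // x [/(_ i)/andP[_ ei] _]; apply: ui.
  by apply: lt_le_trans ei; case/andP: (emb_itv k x i).
have u01 i : 0 < u i <= 1 by rewrite u0; case/andP: (cu i).
rewrite (arch_copula_pos mw n0) // /inv_sum big_ord_recr /=.
under eq_bigr do rewrite widen_lift.
pose a : 'I_n -> R := fun j => phi (u (lift ord_max j)).
pose b := phi (u ord_max).
rewrite -/(\sum_j a j) -/b /psi genE -rsumE; last exact: gen_cvg mw _.
apply: eq_eseriesr => k _.
have a0 j : 0 <= a j := gen_inv_ge0 mw _ n0.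
have b0 : 0 <= b := gen_inv_ge0 mw _ n0.
rewrite -coef_simplex; last by rewrite addr_ge0 // sumr_ge0.
congr (_ * l _)%E; apply/seteqP; split => x.
  move=> [bx Dx]; have /andP[s0 sr] := dom_sum_itv Dx; case: Dx => x0 _; split.
    move=> j; have /andP[_] := bx (lift ord_max j).
    by rewrite emb_lift (gen_le_iff mw).
  have /andP[_] := bx ord_max.
  by rewrite emb_max (gen_le_iff mw) ?subr_ge0 // lerBrDr -lerBrDl lerBrDr.
move=> [ax sx].
have x0 j : 0 <= x j := le_trans (a0 j) (ax j).
have sr : \sum_i x i <= r k by rewrite (le_trans sx) // gerBl.
split; last by split.
move=> i; have /andP[/ltW -> _] /= := emb_itv k x i.
case: (unliftP ord_max i) => [j ->|->].
  by rewrite emb_lift (gen_le_iff mw) //; exact: ax.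
by rewrite emb_max (gen_le_iff mw) ?subr_ge0 // lerBrDr addrC -lerBrDr.
Qed.

Lemma mix_probability_exists :
  exists P : probability (Rsp R n.+1) R, (forall A, P A = mix A) /\
    copula_measure (arch_copula psi) P.
Proof.
have [m [mE _]] := @mixture_exists _ _ _ _ _ l dom coef emb measurable_dom
  (fun k => ltW (coef_gt0 k)) measurable_emb.
have mT : m setT = 1%E by rewrite mE; exact: mix_setT.
have [P PE] := probability_exists mT.
have PmE A : P A = mix A by rewrite PE mE.
exists P; split => //; split => [|u cu]; last by rewrite PmE mix_cdf.
rewrite PmE -mix_setT /mix; apply: eq_eseriesr => k _; congr (_ * l _)%E.
by apply/seteqP; split => x [_ Dx]; split => //; exact: cube_emb.
Qed.

End mixture_copula.

(** * Level masses, Kendall distribution, atoms and support *)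

Section mixture_properties.
Variables (R : realType) (n : nat) (r g : nat -> R).
Hypotheses (mw : mixing_weights n r g) (n0 : (0 < n)%N).
Let psi := gen n r g.
Let phi := gen_inv n r g.
Variable l : {measure set (Rsp R n) -> \bar R}.
Hypothesis lE : forall a s, l (simplex a s) =
  (if (\sum_i a i <= s)%R then ((s - \sum_i a i) ^+ n / n`!%:R)%:E else 0)%E.
Variable mu : probability (Rsp R n.+1) R.
Hypothesis cmu : copula_measure (arch_copula psi) mu.

Let r0 := mw_r_gt0 mw.
Let g0 := mw_g_gt0 mw.

Lemma copula_mixE A : measurable A -> mu A = mix r g l A.
Proof.
move=> mA; have [P [PE cP]] := mix_probability_exists mw n0 lE.
by rewrite -PE; exact: copula_measure_unique cmu cP A mA.
Qed.

(** The inverse carries a subinterval of []x, y[] to an interval of radii, which contains an atom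
    after shifting by [s]. The shift is 0 for levels and the inverse sum of the given coordinates
    for conditional laws. *)
Lemma gen_dense s x y : 0 <= s -> 0 <= x -> x < y -> y <= 1 ->
  exists k, s < r k /\ x < psi (r k - s) < y.
Proof.
move=> s0 x0 xy y1.
(* Points at one and two thirds replace the endpoints, since at [x = 0] there is no inverse
   value. *)
have y01 : 0 < (x + 2 * y) / 3 <= 1 by apply/andP; split; lra.
have x01 : 0 < (2 * x + y) / 3 <= 1 by apply/andP; split; lra.
have a0 := gen_inv_ge0 mw ((x + 2 * y) / 3) n0.
have ab : gen_inv n r g ((x + 2 * y) / 3) < gen_inv n r g ((2 * x + y) / 3).
  by rewrite ltNge -(gen_le_iff mw) // (gen_invK mw) // -ltNge; lra.
have [k /andP[k1 k2]] : exists k, s + gen_inv n r g ((x + 2 * y) / 3) < r k <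
    s + gen_inv n r g ((2 * x + y) / 3).
  by apply: (mw_r_dense mw); [rewrite addr_ge0|rewrite ltrD2l].
exists k; split; first by apply: le_lt_trans k1; rewrite lerDl.
rewrite -ltrBrDl in k1; rewrite -ltrBlDl in k2.
have := gen_lt mw n0 a0 k1; have := gen_lt mw n0 (ltW (le_lt_trans a0 k1)) k2.
by rewrite !(gen_invK mw) // -/psi => h1 h2; apply/andP; split; lra.
Qed.

Lemma copula_level (B : set R) : measurable B ->
  mu [set u | cube R n.+1 u /\ B (arch_copula psi u)] =
  (rsum (fun k => if psi (r k) \in B then g k else 0))%:E.
Proof.
move=> mB; rewrite copula_mixE; first exact: mix_level.
exact: measurable_arch_level.
Qed.

Lemma level_set_gt0 t :
  (0 < mu (level_set (arch_copula psi) t))%E <-> range (psi \o r) t.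
Proof.
rewrite (copula_level (measurable_set1 t)) lte_fin.
have g1 k : 0 <= (if psi (r k) \in [set t] then g k else 0).
  by case: ifP => _ //; exact: ltW.
have cg : cvgn (series (fun k => if psi (r k) \in [set t] then g k else 0)).
  apply: (series_dominated_cvg (mw_cvg_g mw) (M := 1)) => k.
  by rewrite mul1r; case: ifP => _; [rewrite gtr0_norm|rewrite normr0 ltW].
split=> [|[k _ kt]].
  apply: contraPP => nt.
  rewrite (_ : (fun k => _) = fun=> 0).
    have := @rsumZ R 0 _ cg; rewrite mul0r.
    by under [X in rsum X]eq_fun do rewrite mul0r; move=> ->; rewrite ltxx.
  apply/funext => k; case: ifP => // /set_mem kt; exfalso; apply: nt.
  by exists k.
apply: lt_le_trans (rsum_ge_term k cg g1).
by rewrite /= mem_set.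
Qed.

Lemma kendall_step : strict_incr_step (kendall_df (arch_copula psi) mu).
Proof.
apply: (@discrete_df_step _ _ (psi \o r) g setT) => [k||i j _ _ /=|k _ /=|x y x0 xy y1|y y01].
- exact: ltW.
- exact: (mw_cvg_g mw).
- by move=> /(gen_inj mw n0 (ltW (r0 i)) (ltW (r0 j)))/(mw_r_inj mw).
- exact: gen_itv.
- have [k [_ /andP[k1 k2]]] := gen_dense (lexx 0) x0 xy y1.
  by rewrite subr0 in k1 k2; exists k; split => //; exact: ltW.
- have my : measurable [set z : R | z <= y].
    by have := @measurable_itv R `]-oo, y]; rewrite set_itvE.
  rewrite /kendall_df (copula_level my) /=; congr rsum; apply/funext => k.
  by rewrite in_setT /=; congr (if _ then _ else _); apply/idP/idP; rewrite inE.
Qed.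

(** In each component the preimage of a point lies in a degenerate simplex, whose volume is [0 ^+ n]
    up to a factor, hence 0. *)
Lemma copula_no_atoms : no_atoms mu.
Proof.
move=> x; have mx : measurable ([set x] : set (Rsp R n.+1)).
  rewrite (_ : [set x] = [set u | forall i, [set x i] (u i)]).
    by apply: (@measurable_coords _ _ (fun i => [set x i])) => i; exact: measurable_set1.
  by apply/seteqP; split => [_ -> //|u ux]; apply/funext => i; exact: ux.
rewrite copula_mixE // /mix eseries0 // => k _ _.
pose a : 'I_n -> R := fun j => phi (x (lift ord_max j)).
suff : l (emb r g k @^-1` [set x] `&` dom r k) = 0%E by move=> ->; rewrite mule0.
apply/eqP; rewrite eq_le measure_ge0 andbT.
have -> : 0%E = l (simplex a (\sum_i a i)).
  by rewrite lE lexx subrr expr0n gtn_eqF // mul0r.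
apply: le_measure; rewrite ?inE.
- apply: measurableI; last exact: measurable_dom.
  by apply: measurable_preim => //; exact: measurable_emb.
- exact: measurable_simplex.
move=> y [/= yx [y0 _]].
have ay j : a j = y j by rewrite /a -yx emb_lift /phi genK.
by split => [j|]; rewrite ?ay //; under [X in _ <= X]eq_bigr do rewrite ay.
Qed.

Lemma measurable_supball (x : 'I_n.+1 -> R) e :
  measurable (supball x e : set (Rsp R n.+1)).
Proof.
apply: (@measurable_coords _ _ (fun i => [set z | `|z - x i| < e])) => i.
have := @measurable_itv R `]x i - e, x i + e[; rewrite set_itvE.
by congr measurable; apply/seteqP; split => z /=; rewrite ltr_distl.
Qed.

(** Near a point of the cube, pick a radius slightly above the inverse sum: a small simplex of
    positive volume is then mapped into the ball by the Lipschitz bound, and this one component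
    already has positive mass. *)
Lemma copula_full_support : msupport mu = cube R n.+1.
Proof.
apply/seteqP; split => x.
  move=> sx; apply: contrapT => /existsNP[i xi].
  have [e e0 eP] : exists2 e, 0 < e & forall z, `|z - x i| < e -> ~~ (0 <= z <= 1).
    have [x0|x0] := ltP (x i) 0.
      exists (- x i); first by rewrite oppr_gt0.
      move=> z; rewrite ltr_distl => /andP[_ z0]; rewrite negb_and -!ltNge.
      by apply/orP; left; lra.
    have x1 : 1 < x i by rewrite ltNge; apply/negP => x1; apply: xi; rewrite x0.
    exists (x i - 1); first by rewrite subr_gt0.
    move=> z; rewrite ltr_distl => /andP[z0 _]; rewrite negb_and -!ltNge.
    by apply/orP; right; lra.
  have := sx e e0; rewrite (copula_measureI cmu); last exact: measurable_supball.
  rewrite (_ : _ `&` _ = set0) ?measure0 ?ltxx //.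
  apply/seteqP; split => // v [vx cv]; have := eP _ (vx i).
  by rewrite (cv i).
move=> cx e e0.
have [L L0 HL] := gen_lipschitz mw n0.
(* Coordinates near 0 are lifted by at most [e / 4], so that their inverses are finite, without
   leaving the cube. *)
pose c i := Num.max (x i) (Num.min (e / 4) 1).
have c01 i : 0 < c i <= 1.
  have /andP[x0 x1] := cx i.
  by rewrite /c lt_max lt_min ltr01 divr_gt0 // orbT ge_max x1 ge_min lexx orbT.
have cxe i : `|c i - x i| < e / 2.
  have /andP[x0 x1] := cx i.
  rewrite ger0_norm ?subr_ge0 ?le_max ?lexx // ltrBlDr gt_max.
  by rewrite ltrDr divr_gt0 //= gt_min; apply/orP; left; lra.
pose a i := phi (c i).
have a0 i : 0 <= a i := gen_inv_ge0 mw _ n0.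
pose S := \sum_i a i.
have S0 : 0 <= S by rewrite sumr_ge0.
(* A total excess below [e / (2 * L)] moves each coordinate by at most [e / 2] after psi; the other
   half of [e] is spent on [c]. *)
have [k /andP[Sk kS]] : exists k, S < r k < S + e / (2 * L).
  by apply: (mw_r_dense mw) => //; rewrite ltrDl divr_gt0 // mulr_gt0.
pose a' : 'I_n -> R := fun j => a (lift ord_max j).
have SE : S = \sum_i a' i + a ord_max.
  by rewrite /S big_ord_recr /=; under eq_bigr do rewrite widen_lift.
rewrite copula_mixE; last exact: measurable_supball.
apply: (@lt_le_trans _ _ ((coef n r g k)%:E * l (simplex a' (r k - a ord_max)))%E).
  rewrite (coef_simplex mw n0 lE) -SE // lte_fin mulr_gt0 // exprn_gt0 //.
  by rewrite tent_pos ?(ltW Sk) // subr_gt0 ltr_pdivrMr // mul1r.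
have sub : simplex a' (r k - a ord_max) `<=`
    emb r g k @^-1` (supball x e) `&` dom r k.
  move=> y [ay sy].
  have y0 j : 0 <= y j := le_trans (a0 _) (ay j).
  split; last by split => //; rewrite (le_trans sy) // gerBl.
  have close i z : a i <= z -> z - a i <= r k - S -> `|psi z - x i| < e.
    move=> az zS; rewrite (_ : psi z - x i = (psi z - c i) + (c i - x i)); last by ring.
    apply: (le_lt_trans (ler_normD _ _)).
    have : `|psi z - c i| <= e / 2.
      rewrite -(gen_invK mw n0 (c01 i)); apply: (le_trans (HL _ _)).
      rewrite ger0_norm ?subr_ge0 // -ler_pdivlMl //.
      apply: (le_trans zS); rewrite lerBlDl (le_trans (ltW kS)) // lerD2l.
      by rewrite invfM mulrA mulrC.
    by have := cxe i; lra.
  (* All excesses over the corner are nonnegative, so each is at most their sum. *)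
  have sub1 j : y j - a' j <= r k - S.
    have : \sum_i (y i - a' i) <= r k - S.
      by rewrite sumrB SE opprD addrA addrAC lerD2r; move: sy; rewrite addrC.
    apply: le_trans; rewrite (bigD1 j) //= lerDl sumr_ge0 // => i _.
    by rewrite subr_ge0; exact: ay.
  move=> i; case: (unliftP ord_max i) => [j ->|->].
    by rewrite emb_lift; apply: close; [exact: ay|exact: sub1].
  rewrite emb_max; apply: close; first by rewrite lerBrDr addrC -lerBrDr.
  rewrite SE opprD addrA lerD2r lerD2l lerN2.
  by apply: ler_sum => j _; exact: ay.
have le1 : (l (simplex a' (r k - a ord_max)) <=
    l (emb r g k @^-1` (supball x e) `&` dom r k))%E.
  apply: le_measure; rewrite ?inE //; first exact: measurable_simplex.
  apply: measurableI; last exact: measurable_dom.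
  by apply: measurable_preim; [exact: measurable_emb|exact: measurable_supball].
apply: (@le_trans _ _ ((coef n r g k)%:E * l (emb r g k @^-1` (supball x e) `&` dom r k))%E).
  by rewrite lee_pmul2l // lte_fin coef_gt0.
have t0 j : (0 <= (coef n r g j)%:E * l (emb r g j @^-1` (supball x e) `&` dom r j))%E.
  by rewrite mule_ge0 // lee_fin ltW // coef_gt0.
have := @nneseries_lim_ge R (fun j => (coef n r g j)%:E *
  l (emb r g j @^-1` (supball x e) `&` dom r j))%E xpredT 0%N k.+1 (fun j _ _ => t0 j).
apply: le_trans; rewrite big_nat_recr //= leeDr //.
by apply: sume_ge0 => j _; exact: t0.
Qed.

End mixture_properties.

(** * Null sets from countable and finite coverings *)

Section lebesgue_null_sets.
Variable R : realType.

Definition box_vol d (a b : 'I_d -> R) : R := \prod_(i < d) (b i - a i).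

Lemma box_vol_ge0 d (a b : 'I_d -> R) : (forall i, a i <= b i) -> 0 <= box_vol a b.
Proof. by move=> ab; apply: prodr_ge0 => i _; rewrite subr_ge0. Qed.

(** Boxes are renumbered by [pickle]. Codes of no element get the degenerate box at 0, of volume 0
    because the dimension is positive. *)
Lemma lebesgue_null_countType d (N : set ('I_d.+1 -> R)) :
  (forall e : R, 0 < e -> exists (T : countType) (a b : T -> 'I_d.+1 -> R),
    [/\ (forall t i, a t i <= b t i),
        (forall v, N v -> exists t, forall i, a t i <= v i <= b t i) &
        (\esum_(t in [set: T]) (box_vol (a t) (b t))%:E <= e%:E)%E]) ->
  lebesgue_null N.
Proof.
move=> H e e0; have [T [a [b [ab Nab abe]]]] := H e e0.
pose A k i := if @pickle_inv T k is Some t then a t i else 0.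
pose B k i := if @pickle_inv T k is Some t then b t i else 0.
have AB k i : A k i <= B k i by rewrite /A /B; case: pickle_inv.
exists A, B; split => //.
  move=> v /Nab[t vt]; exists (pickle t) => // i.
  by rewrite /A /B pickleK_inv; exact: vt.
have V0 k : (0 <= (box_vol (A k) (B k))%:E)%E by rewrite lee_fin box_vol_ge0.
rewrite (_ : (\sum_(0 <= k <oo) _)%E = (\sum_(k <oo) (box_vol (A k) (B k))%:E)%E) //.
rewrite nneseries_esumT //; apply: le_trans abe.
have bij : set_bij [set: T] (range (@pickle T)) (@pickle T).
  by split=> // x y _ _; exact: (pcan_inj pickleK_inv).
rewrite [leRHS](_ : _ = \esum_(k in range (@pickle T)) (box_vol (A k) (B k))%:E)%E.
  rewrite [leRHS]esum_mkcond; apply: le_esum => k _.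
  case: ifPn => // /negP kT; rewrite lee_fin.
  rewrite /box_vol big_ord_recl /A /B.
  case E : pickle_inv => [t|]; last by rewrite subrr mul0r.
  exfalso; apply: kT; apply/mem_set; exists t => //.
  by have := @pickle_invK T k; rewrite E.
rewrite (@reindex_esum _ _ _ _ _ _ _ bij); apply: eq_esum => t _.
congr (box_vol _ _)%:E; apply/funext => i; by rewrite /A /B pickleK_inv.
Qed.

Lemma lebesgue_null_bigcup d (N : nat -> set ('I_d.+1 -> R)) :
  (forall k, lebesgue_null (N k)) -> lebesgue_null (\bigcup_k N k).
Proof.
move=> HN; apply: lebesgue_null_countType => e e0.
have /choice[ab abP] : forall k, exists ab : (nat -> 'I_d.+1 -> R) * (nat -> 'I_d.+1 -> R),
    [/\ (forall j i, ab.1 j i <= ab.2 j i),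
        N k `<=` \bigcup_j [set v | forall i, ab.1 j i <= v i <= ab.2 j i] &
        (\sum_(0 <= j <oo) (box_vol (ab.1 j) (ab.2 j))%:E <= (e / (2 ^ k.+1)%:R)%:E)%E].
  move=> k; have ek : 0 < e / (2 ^ k.+1)%:R by rewrite divr_gt0 // ltr0n expn_gt0.
  by have [a [b abk]] := HN k _ ek; exists (a, b).
exists (nat * nat)%type, (fun t => (ab t.1).1 t.2), (fun t => (ab t.1).2 t.2); split.
- by move=> t i; have [+ _ _] := abP t.1; exact.
- by move=> v [k _ Nv]; have [_ /(_ v Nv)[j _ vj] _] := abP k; exists (k, j).
have v0 k j : (0 <= (box_vol ((ab k).1 j) ((ab k).2 j))%:E)%E.
  by rewrite lee_fin box_vol_ge0 // => i; have [+ _ _] := abP k; exact.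
rewrite (_ : [set: nat * nat] = [set: nat] `*`` (fun=> [set: nat])); last first.
  by apply/seteqP; split.
rewrite -(@esum_esum _ _ _ _ _ (fun k j => (box_vol ((ab k).1 j) ((ab k).2 j))%:E)) //.
have E0 k : (0 <= \esum_(j in [set: nat]) (box_vol ((ab k).1 j) ((ab k).2 j))%:E)%E.
  by apply: esum_ge0 => j _; exact: v0.
rewrite -nneseries_esumT //.
have := @epsilon_trick0 R e xpredT (ltW e0); apply: le_trans.
apply: lee_nneseries => k _ //.
by rewrite -nneseries_esumT //; have [] := abP k.
Qed.

End lebesgue_null_sets.

Lemma lebesgue_null_finType (R : realType) d (N : set ('I_d.+1 -> R)) :
  (forall e : R, 0 < e -> exists (T : finType) (a b : T -> 'I_d.+1 -> R),
    [/\ (forall t i, a t i <= b t i),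
        (forall v, N v -> exists t, forall i, a t i <= v i <= b t i) &
        \sum_t box_vol (a t) (b t) <= e]) ->
  lebesgue_null N.
Proof.
move=> H; apply: lebesgue_null_countType => e /H[T [a [b [ab Nab abe]]]].
exists T, a, b; split => //.
rewrite esum_fset; [|exact: finite_finset|].
  rewrite (_ : [set: T] = [set` index_enum T]); last first.
    by apply/seteqP; split => // t _ /=; exact: mem_index_enum.
  by rewrite -fsbig_seq ?index_enum_uniq // sumEFin lee_fin.
by move=> t _; rewrite lee_fin box_vol_ge0.
Qed.

Lemma grid_cell (R : realType) (m : nat) (y : R) : 0 <= y <= m.+1%:R ->
  exists j : 'I_m.+1, j%:R <= y <= j%:R + 1.
Proof.
move=> /andP[y0 ym].
have [lt|ge] := ltP y m.+1%:R.
  have ty := truncn_itv y0; have tm : (Num.truncn y < m.+1)%N.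
    by rewrite -(ltr_nat R); case/andP: ty => /le_lt_trans + _; apply.
  exists (Ordinal tm) => /=; case/andP: ty => -> /ltW.
  by rewrite -natr1 => ->.
(* The right endpoint has truncation [m.+1], out of range, and is put into the last closed cell. *)
exists ord_max; rewrite /= natr1 ym andbT.
by apply: le_trans ge; rewrite ler_nat.
Qed.

(** * Level sets are Lebesgue null *)

Section singularity.
Variables (R : realType) (n : nat) (r g : nat -> R).
Hypotheses (mw : mixing_weights n r g) (n0 : (0 < n)%N).
Let psi := gen n r g.
Let phi := gen_inv n r g.

(* In the coordinates x_i = phi (u_i) the level set is the face sum_i x_i = s of
   a simplex; it is covered by m^n boxes of side s / m, elongated n times in the
   last direction, and psi is Lipschitz. *)
Lemma level_set_null s : 0 < s ->
  lebesgue_null (level_set (d := n.+1) (arch_copula psi) (psi s)).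
Proof.
move=> s0; apply: lebesgue_null_finType => e e0.
have [L L0 HL] := gen_lipschitz mw n0.
(* There are [m.+1 ^ n] boxes of volume at most [(L w)^n * (L n w)] with [w = s / m.+1], so the
   total is [K / m.+1]; [m] is chosen to make this at most [e]. *)
pose K := (L * s) ^+ n * (L * (n%:R * s)).
have K0 : 0 <= K by rewrite !mulr_ge0 ?exprn_ge0 ?mulr_ge0 // ltW.
pose m := Num.truncn (K / e).
have mK : K / m.+1%:R <= e.
  rewrite ler_pdivrMr // mulrC -ler_pdivrMr // ltW //.
  exact: truncnS_gt.
pose w : R := s / m.+1%:R.
have w0 : 0 < w by rewrite divr_gt0.
pose T : finType := {ffun 'I_n -> 'I_m.+1}.
pose lo (t : T) j : R := (t j)%:R * w.
pose hi (t : T) j : R := ((t j)%:R + 1) * w.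
have lohi t j : lo t j <= hi t j by rewrite /lo /hi mulrDl lerDl mul1r ltW.
(* Since psi decreases, lower corners come from upper cell ends; the last coordinate is [s] minus
   the others, so there the ends are exchanged once more. *)
pose a (t : T) (i : 'I_n.+1) := if unlift ord_max i is Some j then psi (hi t j)
  else psi (s - \sum_j lo t j).
pose b (t : T) (i : 'I_n.+1) := if unlift ord_max i is Some j then psi (lo t j)
  else psi (s - \sum_j hi t j).
have psile x y : x <= y -> psi y <= psi x by exact: gen_le.
exists T, a, b; split.
- move=> t i; rewrite /a /b; case: unlift => [j|]; apply: psile => //.
  by rewrite lerB // ler_sum.
- move=> u [cu Cu].
  have u0 i : 0 < u i.
    rewrite ltNge; apply/negP => ui; move: Cu.
    rewrite (arch_copula_eq0 mw n0 ui) => /eqP.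
    by rewrite lt_eqF // gen_gt0.
  have u01 i : 0 < u i <= 1 by rewrite u0; case/andP: (cu i).
  pose x i := phi (u i).
  have x0 i : 0 <= x i := gen_inv_ge0 mw _ n0.
  have ux i : u i = psi (x i) by rewrite /psi /x /phi gen_invK.
  have xs : \sum_i x i = s.
    apply: (gen_inj mw n0); rewrite ?sumr_ge0 ?(ltW s0) //.
    by rewrite -[RHS]Cu (arch_copula_pos mw n0).
  have xi i : x i <= s.
    by rewrite -xs (bigD1 i) //= lerDl sumr_ge0.
  have /choice[t tP] : forall j : 'I_n, exists c : 'I_m.+1,
      c%:R * w <= x (lift ord_max j) <= (c%:R + 1) * w.
    move=> j; have [|c] := @grid_cell R m (x (lift ord_max j) / w).
      by rewrite divr_ge0 ?(ltW w0) //= ler_pdivrMr // /w mulrC divfK.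
    by rewrite ler_pdivlMr // ler_pdivrMr // => cP; exists c.
  have xlast : x ord_max = s - \sum_j x (lift ord_max j).
    rewrite -xs big_ord_recr /=; under eq_bigr do rewrite widen_lift.
    by rewrite addrAC subrr add0r.
  exists [ffun j => t j] => i; rewrite ux /a /b.
  case: (unliftP ord_max i) => [j ->|->].
    have /andP[tl th] := tP j.
    by rewrite !psile // /lo /hi ffunE.
  rewrite xlast !psile // lerB // ler_sum // => j _; rewrite /lo /hi ffunE.
    by case/andP: (tP j).
  by case/andP: (tP j).
- have vol t : box_vol (a t) (b t) <= (L * w) ^+ n * (L * (n%:R * w)).
    rewrite /box_vol big_ord_recr /=; apply: ler_pM.
    + by apply: prodr_ge0 => j _; rewrite subr_ge0 widen_lift /a /b liftK psile.
    + by rewrite subr_ge0 /a /b unlift_none psile // lerB // ler_sum.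
    + rewrite -[X in _ <= _ ^+ X](card_ord n) -prodr_const; apply: ler_prod => j _.
      rewrite widen_lift /a /b liftK subr_ge0 psile //=.
      apply: (le_trans (ler_norm _)); apply: (le_trans (HL _ _)).
      rewrite ler_pM2l // distrC ger0_norm ?subr_ge0 //.
      by rewrite /hi /lo mulrDl mul1r addrAC subrr add0r.
    + rewrite /a /b unlift_none.
      apply: (le_trans (ler_norm _)); apply: (le_trans (HL _ _)).
      rewrite ler_pM2l // opprB addrC addrA subrK -normrN opprB -sumrB.
      rewrite ger0_norm; last by apply: sumr_ge0 => j _; rewrite subr_ge0.
      rewrite (eq_bigr (fun=> w)); last first.
        by move=> j _; rewrite /hi /lo mulrDl mul1r addrAC subrr add0r.
      by rewrite sumr_const card_ord mulr_natl.
  apply: (@le_trans _ _ (\sum_(t : T) (L * w) ^+ n * (L * (n%:R * w)))).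
    exact: ler_sum.
  rewrite sumr_const card_ffun !card_ord -[_ *+ _]mulr_natl natrX.
  apply: le_trans mK; rewrite le_eqVlt; apply/orP; left; apply/eqP.
  rewrite /K /w !exprMn exprVn.
  have M0 : m.+1%:R != 0 :> R by rewrite pnatr_eq0.
  have : (m.+1%:R : R) ^+ n != 0 by rewrite expf_neq0.
  move: (L ^+ n) (s ^+ n) (_ ^+ n) => A B D D0; field.
  by rewrite nat1r M0.
Qed.

Variable l : {measure set (Rsp R n) -> \bar R}.
Hypothesis lE : forall a s, l (simplex a s) =
  (if (\sum_i a i <= s)%R then ((s - \sum_i a i) ^+ n / n`!%:R)%:E else 0)%E.

(** The countably many levels psi(r_k) carry total mass [rsum g = 1], while their union is null. *)
Lemma copula_singular (mu : probability (Rsp R n.+1) R) :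
  copula_measure (arch_copula psi) mu -> singular_lebesgue mu.
Proof.
move=> cmu; pose B := \bigcup_k [set psi (r k)].
have mB : measurable B by apply: bigcupT_measurable => k; exact: measurable_set1.
pose N : set (Rsp R n.+1) := [set u | cube R n.+1 u /\ B (arch_copula psi u)].
have mN : measurable N by exact: (measurable_arch_level mw n0).
exists N; split => //.
  rewrite (_ : N = \bigcup_k level_set (d := n.+1) (arch_copula psi) (psi (r k))).
    by apply: lebesgue_null_bigcup => k; apply: level_set_null; exact: mw_r_gt0 mw k.
  apply/seteqP; split => u; first by move=> [cu [k _ Bk]]; exists k.
  by move=> [k _ [cu Bk]]; split => //; exists k.
rewrite probability_setC // (copula_level mw n0 lE cmu mB).
rewrite (_ : (fun k => _) = g); first by rewrite (mw_sum1 mw) subee.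
by apply/funext => k; rewrite mem_set //; exists k.
Qed.

End singularity.

(** * The conditional distribution of the last coordinate *)

Lemma measurable_set0c (R : realType) (y : R) : measurable [set z : R | 0 <= z <= y].
Proof. by have := @measurable_itv R `[0, y]; rewrite set_itvE. Qed.

(** Right-continuity: a rational between [y] and [y + 1/(j+1)] compares [m1] up to [y] with [m2] up
    to [y + 1/(j+1)], and finiteness of [m2] allows [j] to tend to infinity. Applied in both
    directions it gives equality. *)
Lemma measure_cc_le (R : realType) (m1 m2 : {measure set R -> \bar R}) :
  (m2 setT < +oo)%E ->
  (forall q : rat, m1 [set z | 0 <= z <= ratr q] = m2 [set z | 0 <= z <= ratr q]) ->
  forall y : R, (m1 [set z | (0 <= z <= y)%R] <= m2 [set z | (0 <= z <= y)%R])%E.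
Proof.
move=> m2T m12 y.
pose F (j : nat) : set R := [set z | 0 <= z <= y + j.+1%:R^-1].
have mF j : measurable (F j) by exact: measurable_set0c.
have FE : \bigcap_j F j = [set z | 0 <= z <= y].
  apply/seteqP; split => z /=.
    move=> Fz; have /andP[z0 _] := Fz 0%N I; rewrite z0 /=.
    apply/ler_addgt0Pr => e e0.
    have /andP[_ zj] := Fz (Num.truncn e^-1) I.
    apply: (le_trans zj); rewrite lerD2l invf_ple ?posrE //.
    by apply/ltW; exact: truncnS_gt.
  by move=> /andP[z0 zy] j _; rewrite /F /= z0 /= (le_trans zy) // lerDl.
have cv : m2 (F j) @[j --> \oo] --> m2 [set z | 0 <= z <= y].
  rewrite -FE; apply: nonincreasing_cvg_mu => //.
  - by apply: le_lt_trans m2T; apply: le_measure; rewrite ?inE.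
  - by rewrite FE; exact: measurable_set0c.
  - move=> i j ij; apply/subsetPset => z /andP[z0 zj]; rewrite /F /= z0 /=.
    by rewrite (le_trans zj) // lerD2l lef_pV2 ?posrE // ler_nat.
rewrite -(cvg_lim (@ereal_hausdorff R) cv); apply: lime_ge.
  by apply/cvg_ex; exists (m2 [set z | 0 <= z <= y]).
apply: nearW => j.
have yj : y < y + j.+1%:R^-1 by rewrite ltrDl.
have [q /andP[yq qj]] : exists q : rat, y < ratr q < y + j.+1%:R^-1.
  by have [q] := rat_in_itvoo yj; rewrite in_itv /=; exists q.
apply: (@le_trans _ _ (m1 [set z | 0 <= z <= ratr q])).
  apply: le_measure; rewrite ?inE; try exact: measurable_set0c.
  by move=> z /andP[z0 zy]; rewrite /= z0 (le_trans zy) // ltW.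
rewrite m12; apply: le_measure; rewrite ?inE; try exact: measurable_set0c.
by move=> z /andP[z0 zq]; rewrite /F /= z0 (le_trans zq) // ltW.
Qed.

Section kernel.
Variables (R : realType) (n : nat) (r g : nat -> R).
Hypotheses (mw : mixing_weights n r g) (n0 : (0 < n)%N).
Let psi := gen n r g.
Variable l : {measure set (Rsp R n) -> \bar R}.
Hypothesis lE : forall a s, l (simplex a s) =
  (if (\sum_i a i <= s)%R then ((s - \sum_i a i) ^+ n / n`!%:R)%:E else 0)%E.
Variable mu : probability (Rsp R n.+1) R.
Hypothesis cmu : copula_measure (arch_copula psi) mu.

Let c := coef n r g.
Let c_gt0 k : 0 < c k := coef_gt0 mw k.

(** For [Q k] given by [s <= r k] this is the density with respect to [l], at nonnegative points of
    coordinate sum [s], of the first [n] coordinates before psi is applied. *)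
Definition csum (Q : nat -> bool) : R := rsum (fun k => if Q k then c k else 0).

Lemma csum_cvg Q : cvgn (series (fun k => if Q k then c k else 0)).
Proof.
apply: (series_dominated_cvg (coef_cvg mw) (M := 1)) => k.
by rewrite mul1r; case: ifP => _; [rewrite gtr0_norm|rewrite normr0 ltW].
Qed.

Lemma csum_ge0 Q : 0 <= csum Q.
Proof.
have Q0 j : 0 <= (if Q j then c j else 0) by case: ifP => _ //; exact: ltW.
have h := rsum_ge_term 0%N (@csum_cvg Q) Q0.
by apply: (le_trans (Q0 0%N)); exact: h.
Qed.

Lemma csum_le (Q Q' : nat -> bool) : (forall k, Q k -> Q' k) -> csum Q <= csum Q'.
Proof.
move=> QQ'; apply: ler_rsum; try exact: csum_cvg.
move=> k; case: ifPn => [/QQ' -> //|_]; case: ifP => _ //; exact: ltW.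
Qed.

Lemma csum_gt0 s : 0 < csum (fun k => s <= r k).
Proof.
have m0 : 0 <= Num.max 0 s by rewrite le_max lexx.
have [k /andP[sk _]] : exists k, Num.max 0 s < r k < Num.max 0 s + 1.
  by apply: (mw_r_dense mw) => //; rewrite ltrDl.
have Q0 j : 0 <= (if s <= r j then c j else 0) by case: ifP => _ //; exact: ltW.
have h := rsum_ge_term k (@csum_cvg (fun k => s <= r k)) Q0.
apply: (@lt_le_trans _ _ (if s <= r k then c k else 0)); last exact: h.
by rewrite (le_trans _ (ltW sk)) // le_max lexx orbT.
Qed.

Lemma measurable_csum d (T : measurableType d) (Q : nat -> T -> bool) :
  (forall k, measurable_fun setT (Q k)) ->
  measurable_fun setT (fun x => csum (fun k => Q k x)).
Proof.
move=> mQ.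
rewrite (_ : (fun x => _) =
  fine \o (fun x => \sum_(k <oo) (if Q k x then c k else 0)%:E)%E).
  apply: measurableT_comp; first exact: fine_measurable.
  apply: ge0_emeasurable_sum => [k x _ _|k _].
    by rewrite lee_fin; case: ifP => _ //; exact: ltW.
  by apply/measurable_EFinP; apply: measurable_fun_ifT.
by apply/funext => x; rewrite /= rsumE //; exact: csum_cvg.
Qed.

Let tot (x : Rsp R n) : R := \sum_i x i.

Let mtot : measurable_fun setT tot.
Proof. exact: (@measurable_coord_sum R n id (@measurable_id _ _ _)). Qed.

(** Tonelli for the sum over components: it turns a mixture into one integral against the density
    [csum]. *)
Lemma mix_integral (Q : nat -> R -> bool) (F : R -> R) (A : set (Rsp R n)) :
  measurable A -> (forall k, measurable_fun setT (Q k)) ->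
  measurable_fun setT F -> (forall s, 0 <= F s) ->
  (\sum_(k <oo) (c k)%:E * \int[l]_(x in A `&` [set x | Q k (tot x)]) (F (tot x))%:E =
   \int[l]_(x in A) (csum (fun k => Q k (tot x)) * F (tot x))%:E)%E.
Proof.
move=> mA mQ mF F0.
have mFt : measurable_fun setT (fun x => F (tot x)) by exact: measurableT_comp.
have mQt k : measurable_fun setT (fun x => Q k (tot x)) by exact: measurableT_comp.
transitivity (\int[l]_(x in A) (\sum_(k <oo) ((if Q k (tot x) then c k else 0) * F (tot x))%:E))%E.
  rewrite integral_nneseries //; first last.
  - move=> k x _; rewrite lee_fin mulr_ge0 //; case: ifP => _ //; exact: ltW.
  - move=> k; apply: measurable_funTS; apply/measurable_EFinP.
    by apply: measurable_funM => //; apply: measurable_fun_ifT.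
  apply: eq_eseriesr => k _; rewrite integral_mkcondr.
  rewrite -ge0_integralZl //; first last.
  - by rewrite lee_fin ltW.
  - by move=> x _; rewrite patchE; case: ifP => _ //; rewrite lee_fin.
  - apply: measurable_funTS.
    rewrite (_ : _ \_ _ = fun x => if Q k (tot x) then (F (tot x))%:E else 0%E).
      by apply: measurable_fun_ifT => //; exact/measurable_EFinP.
    apply/funext => x; rewrite patchE; congr (if _ then _ else _).
    by apply/idP/idP; rewrite inE.
  apply: eq_integral => x _; rewrite patchE.
  have -> : (x \in [set x | Q k (tot x)]) = Q k (tot x) by apply/idP/idP; rewrite inE.
  by case: ifP => _; rewrite ?mule0 ?mul0r // EFinM.
apply: eq_integral => x _.
rewrite rsumE; last first.
  rewrite (_ : (fun k => _) = fun k => F (tot x) * (if Q k (tot x) then c k else 0)).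
    by apply: is_cvg_seriesZ; exact: csum_cvg.
  by apply/funext => k; rewrite mulrC.
rewrite (_ : (fun k => _) = fun k => F (tot x) * (if Q k (tot x) then c k else 0)).
  rewrite rsumZ; last exact: csum_cvg.
  by rewrite mulrC.
by apply/funext => k; rewrite mulrC.
Qed.

(* [expR (- ln h)] is 1 / h for h > 0, in a form whose measurability is at hand. *)
Definition cond_df (q s : R) : R :=
  csum (fun k => (s <= r k) && (psi (r k - s) <= q)) *
  expR (- ln (csum (fun k => s <= r k))).

Lemma cond_dfE q s : cond_df q s =
  csum (fun k => (s <= r k) && (psi (r k - s) <= q)) / csum (fun k => s <= r k).
Proof. by rewrite /cond_df expRN lnK // posrE csum_gt0. Qed.

Lemma cond_df_itv q s : 0 <= cond_df q s <= 1.
Proof.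
rewrite cond_dfE divr_ge0 ?csum_ge0 //= ler_pdivrMr ?csum_gt0 // mul1r.
by apply: csum_le => k /andP[].
Qed.

Let mle k : measurable_fun setT (fun s : R => s <= r k).
Proof. by apply: measurable_fun_ler. Qed.

Let mQ q k : measurable_fun setT (fun s : R => (s <= r k) && (psi (r k - s) <= q)).
Proof.
apply: measurable_and => //; apply: measurable_fun_ler => //.
apply: (measurableT_comp (measurable_gen mw n0)).
exact: measurable_funB.
Qed.

Lemma measurable_cond_df q : measurable_fun setT (cond_df q).
Proof.
apply: measurable_funM; first by apply: measurable_csum.
apply: (measurableT_comp (@measurable_expR R)).
apply: measurableT_comp; first exact: oppr_measurable.
by apply: (measurableT_comp (@measurable_ln R)); apply: measurable_csum.
Qed.

Variable nu : probability (Rsp R n) R.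
Hypothesis munu : is_marginal mu nu.
Variable K : R.-pker (Rsp R n) ~> R.
Hypothesis muK : is_markov_kernel mu nu K.

Let E0 : Rsp R n -> Rsp R n := emb0 r g.
Let D0 : set (Rsp R n) := [set x | forall i, 0 <= x i].

Let mD0 : measurable D0.
Proof.
apply: (@measurable_coords _ _ (fun=> [set z | 0 <= z])) => i.
by have := @measurable_itv R `[0, +oo[; rewrite set_itvE.
Qed.

(** Each [dom k] is split into the orthant [D0], common to all [k], and a condition on the
    coordinate sum alone, which is the shape that [mix_integral] absorbs into [csum]. *)
Lemma marginal_integral (f : Rsp R n -> \bar R) (A : set (Rsp R n)) :
  measurable A -> measurable_fun setT f -> (forall x, (0 <= f x)%E) ->
  (\int[nu]_(x in A) f x =
   \sum_(k <oo) (c k)%:E *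
     \int[l]_(x in (E0 @^-1` A `&` D0) `&` [set x | (tot x <= r k)%R]) f (E0 x))%E.
Proof.
move=> mA mf f0.
have [m [mE mI]] := @mixture_exists _ _ _ _ _ l (dom r) c (fun=> E0)
  (@measurable_dom R n r) (fun k => ltW (c_gt0 k)) (fun=> measurable_emb0 mw n0).
have nuE B : measurable B -> nu B = m B.
  move=> mB; rewrite munu // (copula_mixE mw n0 lE cmu); last first.
    by apply: (measurable_preim (@measurable_initc R n)).
  rewrite mE /mix; apply: eq_eseriesr => k _; congr (_ * l _)%E.
  by apply/seteqP; split => x /=; rewrite initc_emb.
rewrite (eq_measure_integral m); last by move=> B mB _; exact: nuE.
rewrite mI //; apply: eq_eseriesr => k _; apply: congr1; congr (integral _ _ _).
rewrite -setIA; congr (_ `&` _); exact/seteqP.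
Qed.

(** Both sides have equal integrals over every measurable [A]: against the marginal density the
    denominator of [cond_df] cancels, and its numerator integrates to the joint mass. *)
Lemma markov_kernel_ae (q : R) :
  {ae nu, forall u, setT u ->
    K u [set z | 0 <= z <= q] = (cond_df q (inv_sum n r g u))%:E}.
Proof.
have mB : measurable [set z : R | 0 <= z <= q] by exact: measurable_set0c.
have mS : measurable_fun setT (fun u : Rsp R n => cond_df q (inv_sum n r g u)).
  exact: (measurableT_comp (measurable_cond_df q) (measurable_inv_sum mw n0 (d := n))).
have mK : measurable_fun setT (fun u => K u [set z | 0 <= z <= q]).
  exact: measurable_kernel.
have K1 u : (K u [set z | (0 <= z <= q)%R] <= 1)%E.
  rewrite -(prob_kernel (s := K) u); apply: le_measure; rewrite ?inE //.
apply: integral_ae_eq => //.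
- apply: (@le_integrable _ _ _ _ _ measurableT _ (EFin \o cst 1)) => //.
    by move=> u _; rewrite /= normr1 gee0_abs.
  exact: finite_measure_integrable_cst.
- by apply/measurable_EFinP.
move=> A _ mA.
rewrite -muK // (copula_mixE mw n0 lE cmu); last first.
  apply: measurableI; first exact: (measurable_preim (@measurable_initc R n)).
  exact: (@measurable_coord_set R n.+1 ord_max).
have mA' : measurable (E0 @^-1` A `&` D0).
  by apply: measurableI => //; apply: measurable_preim => //; exact: measurable_emb0.
rewrite marginal_integral //; last 2 first.
- by apply/measurable_EFinP.
- by move=> u; rewrite lee_fin; case/andP: (cond_df_itv q (inv_sum n r g u)).
transitivity (\sum_(k <oo) (c k)%:E *
    \int[l]_(x in (E0 @^-1` A `&` D0) `&` [set x | (tot x <= r k)%R]) (cond_df q (tot x))%:E)%E;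
    last first.
  apply: eq_eseriesr => k _; apply: congr1; apply: eq_integral => x.
  move=> /set_mem[[_ x0] _].
  by rewrite (inv_sum_emb0 mw n0 x0).
rewrite (@mix_integral (fun k s => s <= r k)) //; first last.
- by move=> s; case/andP: (cond_df_itv q s).
- exact: measurable_cond_df.
(* The density of the marginal is exactly the denominator in [cond_dfE]; after cancelling, the
   constant function 1 remains in the role of [F]. *)
transitivity (\int[l]_(x in E0 @^-1` A `&` D0)
   (csum (fun k => (tot x <= r k) && (psi (r k - tot x) <= q)) * 1)%:E)%E; last first.
  apply: eq_integral => x _; congr EFin; rewrite cond_dfE mulr1 mulrC divfK //.
  by rewrite gt_eqF // csum_gt0.
rewrite -(@mix_integral (fun k s => (s <= r k) && (psi (r k - s) <= q)) (fun=> 1)) //.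
rewrite /mix; apply: eq_eseriesr => k _; apply: congr1.
rewrite (_ : (fun x => 1%:E) = cst 1%E) // integral_cst ?mul1e; last first.
  apply: measurableI => //.
  have := measurableT_comp (mQ q k) mtot.
  by move=> /(_ measurableT [set true] I); rewrite setTI.
congr (l _); apply/seteqP; split => x.
  move=> [[Ax /andP[_ xq]] [x0 xs]]; split.
    by split => //; move: Ax; rewrite initc_emb.
  rewrite /= /tot xs /=; move: xq; by rewrite /lastc emb_max.
move=> [[Ax x0] /andP[xs xq]]; split; last by split.
split; first by rewrite initc_emb.
rewrite /lastc /= emb_max xq andbT.
by case/andP: (gen_itv mw (r k - \sum_i x i)).
Qed.

(** Outside one null set the kernel agrees with [cond_df] at all rational endpoints. For such a [u]
    an explicit discrete law with these values is compared with the kernel, and right-continuity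
    extends the agreement to all endpoints. *)
Lemma markov_kernel_step :
  {ae nu, forall u, strict_incr_step (fun y => fine (K u [set z : R | 0 <= z <= y]))}.
Proof.
pose qs (j : nat) : rat := odflt 0 (unpickle j).
have : {ae nu, forall u, forall j, setT u ->
    K u [set z | 0 <= z <= ratr (qs j)] = (cond_df (ratr (qs j)) (inv_sum n r g u))%:E}.
  by apply: ae_foralln => j; exact: markov_kernel_ae.
apply: filterS => u Ku.
set s := inv_sum n r g u.
have s0 : 0 <= s by apply: sumr_ge0 => i _; exact: gen_inv_ge0.
have h0 : 0 < csum (fun k => s <= r k) by exact: csum_gt0.
set h := csum (fun k => s <= r k) in h0.
pose w k := c k / h.
have w0 k : 0 < w k by rewrite divr_gt0.
have cw : cvgn (series w).
  rewrite (_ : w = fun k => h^-1 * c k); last by apply/funext => k; rewrite mulrC.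
  by apply: is_cvg_seriesZ; exact: (coef_cvg mw).
pose D := [set k | s <= r k].
have inD k : (k \in D) = (s <= r k) by apply/idP/idP; rewrite inE.
pose G y := rsum (fun k => if (k \in D) && (psi (r k - s) <= y) then w k else 0).
have GE y : G y = cond_df y s.
  rewrite cond_dfE -/h mulrC -rsumZ; last exact: csum_cvg.
  rewrite /G; congr rsum; apply/funext => k; rewrite inD.
  by case: ifP => _; rewrite ?mulr0 // mulrC.
have cG y : cvgn (series (fun k => if (k \in D) && (psi (r k - s) <= y) then w k else 0)).
  apply: (series_dominated_cvg cw (M := 1)) => k; rewrite mul1r.
  by case: ifP => _; [rewrite gtr0_norm|rewrite normr0 ltW].
(* A mixture over a one-point space: component [k] is a point mass at [psi (r k - s)], absent if
   [r k < s]. *)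
pose U k : set unit := if s <= r k then setT else set0.
have mU k : measurable (U k) by rewrite /U; case: ifP.
have mp k : measurable_fun setT ((fun=> psi (r k - s)) : unit -> R).
  exact: measurable_cst.
pose dt : {measure set unit -> \bar R} := \d_tt.
have [m [mE _]] := mixture_exists dt mU (fun k => ltW (w0 k)) mp.
have mG y : m [set z | 0 <= z <= y] = (G y)%:E.
  rewrite mE -rsumE //; apply: eq_eseriesr => k _; rewrite inD.
  rewrite /U; case: ifP => sk /=; last by rewrite setI0 measure0 mule0.
  rewrite setIT diracE; case: ifP => py.
    rewrite mem_set ?mule1 //= py andbT.
    by case/andP: (gen_itv mw (r k - s)).
  by rewrite memNset ?mule0 //= py andbF.
have GK (q : rat) : K u [set z | 0 <= z <= ratr q] = m [set z | 0 <= z <= ratr q].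
  by have := Ku (pickle q) I; rewrite mG GE /qs pickleK.
have mT : (m setT < +oo)%E.
  apply: (@le_lt_trans _ _ (\sum_(k <oo) (w k)%:E)%E); last by rewrite rsumE // ltry.
  rewrite mE; apply: lee_nneseries => k _.
    by rewrite mule_ge0 // lee_fin ltW.
  rewrite -[leRHS]mule1 lee_pmul2l ?lte_fin //.
  exact: probability_le1.
have KT : (K u setT < +oo)%E by rewrite prob_kernel ltry.
have KG y : fine (K u [set z : R | 0 <= z <= y]) = G y.
  suff -> : K u [set z : R | 0 <= z <= y] = (G y)%:E by [].
  rewrite -mG; apply/eqP; rewrite eq_le; apply/andP; split.
    exact: (measure_cc_le mT GK y).
  exact: (measure_cc_le KT (fun q => esym (GK q)) y).
apply: (@discrete_df_step _ _ (fun k => psi (r k - s)) w D) => //.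
- by move=> k; exact: ltW.
- move=> i j Di Dj /(gen_inj mw n0); rewrite !subr_ge0 => /(_ Di Dj).
  by move=> /addIr/(mw_r_inj mw).
- by move=> k _; exact: gen_itv.
- move=> x y x0 xy y1.
  have [k [sk /andP[k1 k2]]] := gen_dense mw n0 s0 x0 xy y1.
  by exists k; split => //; exact: ltW.
Qed.

End kernel.

(** * Existence of the weights and normalisation of the generator *)

Lemma mixing_weights_exist (R : realType) (n : nat) :
  exists r g : nat -> R, mixing_weights n r g.
Proof.
have /card_set_bijP[f [_ finj fsurj]] : ([set: nat] #= [set: rat])%card.
  by rewrite card_eq_sym; exact: card_rat.
(* Exponentials of an enumeration of the rationals: positive, pairwise distinct and dense in the
   half-line. *)
pose r k : R := expR (ratr (f k)).
have r0 k : 0 < r k by exact: expR_gt0.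
pose v k : R := 1 + r k + r k ^- n.
have v0 k : 0 < v k.
  by rewrite /v addr_gt0 // ?invr_gt0 ?exprn_gt0 // addr_gt0.
have v1 k : 1 <= v k.
  by rewrite /v -addrA lerDl addr_ge0 ?invr_ge0 ?exprn_ge0 ?ltW.
pose p k : R := 2^-1 ^+ k.
have p0 k : 0 < p k by rewrite exprn_gt0 // invr_gt0.
have cp : cvgn (series p).
  have := @is_cvg_geometric_series R 1 2^-1.
  rewrite (_ : geometric 1 2^-1 = p); last by apply/funext => k /=; rewrite mul1r.
  by apply; rewrite ger0_norm ?invr_ge0 // invf_lt1 // ltr1n.
(* Dividing a geometric sequence by [v] makes the series in [mw_cvg] geometric. *)
pose g0 k : R := p k / v k.
have g00 k : 0 < g0 k by rewrite divr_gt0.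
have cg0 : cvgn (series g0).
  apply: (series_dominated_cvg cp (M := 1)) => k.
  by rewrite mul1r gtr0_norm // ler_pdivrMr // ler_peMr // ltW.
pose Z := rsum g0.
have Z0 : 0 < Z.
  exact: lt_le_trans (g00 0%N) (rsum_ge_term 0%N cg0 (fun k => ltW (g00 k))).
exists r, (fun k => Z^-1 * g0 k); split => //.
- by move=> k; rewrite mulr_gt0 // invr_gt0.
- move=> i j /expR_inj /fmorph_inj fij.
  by apply: finj; rewrite ?in_setT.
- move=> a b a0 ab.
  have b0 : 0 < b by exact: le_lt_trans ab.
  (* The endpoint [a] may be 0, so it is raised to a positive number below [b] before taking
     logarithms. *)
  have m0 : 0 < Num.max a (b / 2) by rewrite lt_max divr_gt0 // orbT.
  have mb : Num.max a (b / 2) < b.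
    by rewrite gt_max ab ltr_pdivrMr // ltr_pMr // ltr1n.
  have lnm : ln (Num.max a (b / 2)) < ln b by rewrite ltr_ln ?posrE.
  have [q] := rat_in_itvoo lnm; rewrite in_itv /= => /andP[q1 q2].
  have [k _ fk] := fsurj q I.
  exists k; rewrite /r fk -[X in _ < _ < X]lnK ?posrE // ltr_expR q2 andbT.
  apply: (@le_lt_trans _ _ (Num.max a (b / 2))); first by rewrite le_max lexx.
  by rewrite -[X in X < _]lnK ?posrE // ltr_expR.
- rewrite (_ : (fun k => _) = fun k => Z^-1 * p k); first exact: is_cvg_seriesZ.
  by apply/funext => k; rewrite -/(v k) /g0 -mulrA divfK ?gt_eqF.
- by rewrite rsumZ // mulVf // gt_eqF.
Qed.

(** Dividing all radii by the point [z] where psi equals 1/2 replaces psi by psi(z x), without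
    touching the weights. *)
Lemma mixing_weights_half (R : realType) (n : nat) : (0 < n)%N ->
  exists r g : nat -> R, mixing_weights n r g /\ gen n r g 1 = 2^-1.
Proof.
move=> n0; have [r [g mw]] := mixing_weights_exist R n.
have r0 := mw_r_gt0 mw; have g0 := mw_g_gt0 mw.
have h01 : 0 < (2^-1 : R) <= 1 by rewrite invr_gt0 ltr0n /= invf_le1 // ler1n.
have [z z0 gz] := gen_surj mw n0 h01.
have {}z0 : 0 < z.
  rewrite lt_neqAle z0 andbT; apply/eqP => zz; move: gz.
  rewrite -zz (gen_neg mw) // => h; have : (2^-1 : R) < 1 by rewrite invf_lt1 // ltr1n.
  by rewrite -h ltxx.
exists (fun k => r k / z), g; split; last first.
  rewrite genE -gz genE; congr rsum; apply/funext => k.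
  by rewrite /tent (max_r (ltW z0)) (max_r ler01) mul1r invf_div.
split.
- by move=> k; rewrite divr_gt0.
- exact: g0.
- move=> i j /(mulIf _) e; apply: (mw_r_inj mw); apply: e.
  by rewrite invr_eq0 gt_eqF.
- move=> a b a0 ab.
  have [k /andP[k1 k2]] : exists k, a * z < r k < b * z.
    by apply: (mw_r_dense mw); [rewrite mulr_ge0 // ltW|rewrite ltr_pM2r].
  by exists k; rewrite ltr_pdivlMr // k1 ltr_pdivrMr.
(* The rescaled factor [1 + r k / z + z ^+ n * r k ^- n] is dominated term by term by the product of
   [M] with the original factor. *)
- apply: (series_dominated_cvg (mw_cvg mw) (M := 1 + z^-1 + z ^+ n)) => k.
  have a0 : 0 < z^-1 by rewrite invr_gt0.
  have b0 : 0 < z ^+ n by rewrite exprn_gt0.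
  have x0 := r0 k; have y0 : 0 < r k ^- n by rewrite invr_gt0 exprn_gt0.
  have -> : (r k / z) ^- n = r k ^- n * z ^+ n.
    by rewrite expr_div_n invf_div mulrC.
  rewrite ger0_norm; last first.
    by rewrite mulr_ge0 ?ltW // addr_gt0 ?mulr_gt0 // addr_gt0 // mulr_gt0.
  rewrite mulrCA ler_wpM2l ?ltW //; nra.
- exact: mw_sum1 mw.
Qed.

(* d = n.+1 with d >= 3 *)
Theorem theorem6p2 (R : realType) (n : nat) (hn : (2 <= n)%N) :
  exists psi : R -> R,
    arch_generator n.+1 psi /\
    let C := arch_copula (d := n.+1) psi in
    (exists mu : probability (Rsp R n.+1) R, copula_measure C mu) /\
    forall mu : probability (Rsp R n.+1) R, copula_measure C mu ->
    [/\ (* (1) *)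
        singular_lebesgue mu /\ no_atoms mu /\ msupport mu = cube R n.+1,
        (* (2) *)
        (forall (nu : probability (Rsp R n) R) (K : R.-pker (Rsp R n) ~> R),
           is_marginal mu nu -> is_markov_kernel mu nu K ->
           {ae nu, forall x, strict_incr_step
                     (fun y => fine (K x [set z : R | 0 <= z <= y]))}),
        (* (3) *)
        (exists Q : set R,
           [/\ countable Q, Q `<=` [set t | 0 < t < 1],
               (forall a b, 0 <= a -> a < b -> b <= 1 -> exists2 q, Q q & a < q < b) &
               forall t : R, (0 < mu (level_set C t : set (Rsp R n.+1)))%E <-> Q t]) &
        (* (4) *)
        strict_incr_step (kendall_df C mu)].
Proof.
have n0 : (0 < n)%N by exact: ltnW.
have [r [g [mw half]]] := @mixing_weights_half R n n0.
have [l [_ lE]] := lebesgue_Rsp_exists R n.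
exists (gen n r g); split; first exact: gen_arch_generator.
move=> C; split.
  by have [P [_ cP]] := mix_probability_exists mw n0 lE; exists P.
move=> mu cmu; split.
- split; first exact: (copula_singular mw n0 lE cmu).
  split; first exact: (copula_no_atoms mw n0 lE cmu).
  exact: (copula_full_support mw n0 lE cmu).
- move=> nu K munu muK; exact: (markov_kernel_step mw n0 lE cmu munu muK).
- exists (range (gen n r g \o r)); split.
  + apply: (sub_countable (card_image_le _ _)); exact: countableP.
  + move=> _ [k _ <-] /=; rewrite (gen_gt0 mw) // -(gen_neg mw (lexx 0)).
    by apply: (gen_lt mw) => //; exact: mw_r_gt0 mw k.
  + move=> a b a0 ab b1.
    have [k [_ kab]] := gen_dense mw n0 (lexx 0) a0 ab b1.
    by rewrite subr0 in kab; exists (gen n r g (r k)) => //; exists k.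
  + exact: (level_set_gt0 mw n0 lE cmu).
- exact: (kendall_step mw n0 lE cmu).
Qed.
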